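(* Let $\mathbb{X}\subseteq\mathbb{P}^2$ be a $\Bbbk$-configuration of type $(1,2,\dots,s)$ with $s\ge2$, and assume there are exactly $s+1$ lines in $\mathbb{P}^2$ containing $s$ points of $\mathbb{X}$. Then $\Delta\mathbf{H}_{m\mathbb{X}}(ms-1)=s+1$ for all integers $m\ge2$.
   Context: $\Bbbk$ is an algebraically closed field and $R=\Bbbk[x_0,x_1,x_2]$. A $\Bbbk$-configuration of type $(d_1,\dots,d_s)$ is a finite set $\mathbb{X}\subseteq\mathbb{P}^2$ for which there exist integers $1\le d_1<\cdots<d_s$, subsets $\mathbb{X}_1,\dots,\mathbb{X}_s$ of $\mathbb{X}$ and distinct lines $\mathbb{L}_1,\dots,\mathbb{L}_s\subseteq\mathbb{P}^2$ such that (1) $\mathbb{X}=\bigcup_{i=1}^s\mathbb{X}_i$; (2) $|\mathbb{X}_i|=d_i$ and $\mathbb{X}_i\subseteq\mathbb{L}_i$ for each $i$; (3) for $1<i\le s$, $\mathbb{L}_i$ contains no point of $\mathbb{X}_j$ for any $j<i$. For $\mathbb{X}=\{P_1,\dots,P_n\}$ and $m\ge1$, $m\mathbb{X}$ is the fat point scheme with ideal $I_{m\mathbb{X}}=I_{P_1}^m\cap\cdots\cap I_{P_n}^m$, where $I_P$ is the ideal of $P$. $\mathbf{H}_\mathbb{Z}(t)=\dim_\Bbbk R_t-\dim_\Bbbk(I_\mathbb{Z})_t$ and $\Delta\mathbf{H}_\mathbb{Z}(t)=\mathbf{H}_\mathbb{Z}(t)-\mathbf{H}_\mathbb{Z}(t-1)$,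 with $\mathbf{H}_\mathbb{Z}(t)=0$ for $t<0$. *)

(* Defs.v *)
From HB Require Import structures.
From mathcomp Require Import all_boot all_order all_algebra.
Set Implicit Arguments. Unset Strict Implicit. Unset Printing Implicit Defensive.
Import Order.TTheory GRing.Theory Num.Theory.
Local Open Scope ring_scope.

Section Defs.
Variable K : closedFieldType.

(* ---------- The polynomial ring R = K[x0,x1,x2] ----------
   Modelled as nested univariate polynomials K[x0][x1][x2]:
   x2 = 'X (outermost), x1 = 'X%:P, x0 = 'X%:P%:P. *)
Definition R3 := {poly {poly {poly K}}}.

Definition coef3 (F : R3) (i j k : nat) : K := ((F`_k)`_j)`_i.

Definition const3 (c : K) : R3 := c%:P%:P%:P.

Definition eval3 (F : R3) (a : 'rV[K]_3) : K :=
  ((F.[(a 0 2%:R)%:P%:P]).[(a 0 1%:R)%:P]).[a 0 0].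

(* F is homogeneous of degree t (0 is homogeneous of every degree),
   i.e. F belongs to R_t *)
Definition homog (t : nat) (F : R3) : Prop :=
  forall i j k : nat, coef3 F i j k != 0 -> (i + j + k)%N = t.

Definition lin_indep (fs : seq R3) : Prop :=
  forall cs : seq K, size cs = size fs ->
    \sum_(i < size fs) const3 cs`_i * fs`_i = 0 ->
    forall i, (i < size cs)%N -> cs`_i = 0.

Definition is_dim (S : R3 -> Prop) (d : nat) : Prop :=
  (exists fs : seq R3, size fs = d /\ (forall i, (i < d)%N -> S fs`_i)
                       /\ lin_indep fs) /\
  (forall fs : seq R3, size fs = d.+1 -> (forall i, (i < d.+1)%N -> S fs`_i)
                       -> ~ lin_indep fs).

Definition ideal_gen (G : R3 -> Prop) (F : R3) : Prop :=
  exists gs cs : seq R3, size gs = size cs /\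
    (forall i, (i < size gs)%N -> G gs`_i) /\
    F = \sum_(i < size gs) cs`_i * gs`_i.

Definition ideal_pow (I : R3 -> Prop) (m : nat) : R3 -> Prop :=
  ideal_gen (fun g => exists l : seq R3, size l = m /\
                       (forall i, (i < m)%N -> I l`_i) /\ g = \prod_(x <- l) x).

(* ---------- Points and lines of P^2 ----------
   A point [a0:a1:a2] (resp. a line a0 x0 + a1 x1 + a2 x2 = 0) is represented by
   its normalized coordinate vector: first nonzero coordinate equal to 1. *)
Definition normalized (v : 'rV[K]_3) : bool :=
  (v 0 0 == 1) ||
  ((v 0 0 == 0) && (v 0 1%:R == 1)) ||
  [&& v 0 0 == 0, v 0 1%:R == 0 & v 0 2%:R == 1].

Record pvec := PVec { pval :> 'rV[K]_3; _ : normalized pval }.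
HB.instance Definition _ := [isSub for pval].
HB.instance Definition _ := [Equality of pvec by <:].

Definition ppoint := pvec.
Definition pline := pvec.

Definition on_line (L : pline) (P : ppoint) : bool :=
  \sum_(i < 3) (pval L) 0 i * (pval P) 0 i == 0.

Definition ideal_pt (P : ppoint) : R3 -> Prop :=
  ideal_gen (fun g => exists t, homog t g /\ eval3 g (pval P) = 0).

Definition fat_ideal (m : nat) (X : seq ppoint) (F : R3) : Prop :=
  forall P, P \in X -> ideal_pow (ideal_pt P) m F.

Definition hilb (I : R3 -> Prop) (t : nat) (h : nat) : Prop :=
  exists dR dI : nat, is_dim (homog t) dR /\
    is_dim (fun F => homog t F /\ I F) dI /\ h = (dR - dI)%N.

Definition kconfig (X : seq ppoint) (ds : seq nat) : Prop :=
  uniq X /\ sorted ltn ds /\ all (fun d => 0 < d)%N ds /\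
  exists (Xs : 'I_(size ds) -> seq ppoint) (Ls : 'I_(size ds) -> pline),
    injective Ls /\
    (forall i, uniq (Xs i) /\ size (Xs i) = nth 0%N ds i /\
               (forall P, P \in Xs i -> on_line (Ls i) P)) /\
    (forall i j : 'I_(size ds), (j < i)%N ->
       forall P, P \in Xs j -> ~~ on_line (Ls i) P) /\
    (forall P, P \in X <-> exists i, P \in Xs i).
End Defs.

(* Main.v *)
(* The union bound over the [s + 1] lines shows that any [s] of them already
   contain all the points of [X], so every point lies on at least two of them.
   Write [V_t] for the forms of degree [t] in the ideal of [m X]. Take a line [l]
   missing [X] and meeting the [s + 1] lines in distinct points, and restrict
   [V_(ms-1)] to [l]. The kernel is [l V_(ms-2)]. A form of [V_(ms-1)] restricted
   to one of the [s + 1] lines has degree [< ms] and [s] zeros of order [m], so it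
   vanishes there; hence the restriction to [l] is divisible by the product [q] of
   the restricted equations of the [s + 1] lines. Conversely every [q g] with
   [deg g <= (m-2)s + s-2] is attained: the product of all the lines has order 2
   on [X], and [g] lifts to order [m-2] because the products of [s] of the lines,
   which have order 1 on [X], interpolate every binary form of degree [s] on [l].
   So [dim V_(ms-1) - dim V_(ms-2) = (m-1)s - 1], while
   [dim R_(ms-1) - dim R_(ms-2) = ms]. *)
Require Import Defs.
From HB Require Import structures.
From mathcomp Require Import all_boot all_order all_algebra ring zify.
From Stdlib Require Import Classical.
Import GRing.Theory Num.Theory.

Set Implicit Arguments.
Unset Strict Implicit.
Unset Printing Implicit Defensive.

(** * Trivariate polynomials as nested univariate polynomials *)

Section NestedPolynomials.
Local Open Scope ring_scope.
Variable K : closedFieldType.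

Lemma ord3_ind (Q : 'I_3 -> Prop) : Q 0 -> Q 1%:R -> Q 2%:R -> forall i, Q i.
Proof.
move=> h0 h1 h2 i; have : i \in [:: 0; 1%:R; 2%:R].
  by case: i => [[|[|[|]]]].
by rewrite !inE => /or3P[] /eqP->.
Qed.

Lemma sum3 (V : nmodType) (f : 'I_3 -> V) :
  \sum_(i < 3) f i = f 0 + f 1%:R + f 2%:R.
Proof.
rewrite !big_ord_recr big_ord0 /= add0r.
by congr (f _ + f _ + f _); apply/val_inj.
Qed.

Local Notation R3 := {poly {poly {poly K}}}.
Implicit Types (F G : R3).

Definition nested_var (i : 'I_3) : R3 :=
  if i == 0 then 'X%:P%:P else if i == 1%:R then 'X%:P else 'X.

Lemma nested_var0 : nested_var 0 = 'X%:P%:P. Proof. by []. Qed.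
Lemma nested_var1 : nested_var 1%:R = 'X%:P. Proof. by []. Qed.
Lemma nested_var2 : nested_var 2%:R = 'X. Proof. by []. Qed.

Definition nested_cst : K -> R3 := @const3 K.

Lemma nested_cst_is_monoid_morphism : monoid_morphism nested_cst.
Proof.
split=> [|x y]; first by rewrite /nested_cst /const3 !polyC1.
change (const3 (x * y) = const3 x * const3 y :> {poly {poly {poly K}}}).
by rewrite /const3 !polyCM.
Qed.
Lemma nested_cst_is_zmod_morphism : zmod_morphism nested_cst.
Proof.
move=> x y; change (const3 (x - y) = const3 x - const3 y :> {poly {poly {poly K}}}).
by rewrite /const3 !polyCB.
Qed.
HB.instance Definition _ := GRing.isZmodMorphism.Build K R3 nested_cst nested_cst_is_zmod_morphism.
HB.instance Definition _ := GRing.isMonoidMorphism.Build K R3 nested_cst nested_cst_is_monoid_morphism.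

Definition nested_mono (i j k : nat) : R3 :=
  nested_var 0 ^+ i * nested_var 1%:R ^+ j * nested_var 2%:R ^+ k.

Lemma nested_monoE c i j k :
  nested_cst c * nested_mono i j k = (((c%:P * 'X^i)%:P * 'X^j)%:P * 'X^k : {poly {poly {poly K}}}).
Proof.
rewrite !polyCM !rmorphXn /= -!mulrA.
by congr (_ * _); rewrite /nested_mono -mulrA.
Qed.

Lemma nested_coef_mono c i j k i' j' k' :
  coef3 (nested_cst c * nested_mono i j k) i' j' k' =
  if [&& i' == i, j' == j & k' == k] then c else 0.
Proof.
rewrite nested_monoE /coef3 coefCM coefXn.
case: eqP => _; last by rewrite !andbF mulr0 !coef0.
rewrite mulr1 coefCM coefXn.
case: eqP => _; last by rewrite !andbF mulr0 !coef0.
by rewrite mulr1 coefCM coefXn !andbT; case: eqP; rewrite ?mulr1 ?mulr0.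
Qed.

Lemma nested_coefD F G i j k : coef3 (F + G) i j k = coef3 F i j k + coef3 G i j k.
Proof. by rewrite /coef3 (coefD (F : {poly {poly {poly K}}})) !coefD. Qed.

Lemma nested_coefZ c F i j k : coef3 (nested_cst c * F) i j k = c * coef3 F i j k.
Proof. by rewrite /coef3 (coefCM (c%:P%:P : {poly {poly K}})) !coefCM. Qed.

Lemma nested_expand F : exists (s : seq (nat * nat * nat)),
  F = \sum_(x <- s) nested_cst (coef3 F x.1.1 x.1.2 x.2) * nested_mono x.1.1 x.1.2 x.2.
Proof.
move: F => p.
(* Exponents are listed from the outermost layer inwards, so that each of the three sums is the
   coefficient expansion of one univariate layer. *)
exists [seq (ji.2, ji.1, k) | k <- iota 0 (size p),
   ji <- [seq (j, i) | j <- iota 0 (size p`_k), i <- iota 0 (size p`_k`_j)]].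
rewrite big_allpairs_dep /= -[LHS]coefK poly_def.
rewrite -(big_mkord xpredT (fun k => p`_k *: 'X^k)) /index_iota subn0.
apply: eq_bigr => k _.
rewrite big_allpairs_dep /= -mul_polyC -[p`_k in LHS]coefK poly_def rmorph_sum mulr_suml.
rewrite -(big_mkord xpredT (fun j => (p`_k`_j *: 'X^j)%:P * 'X^k)) /index_iota subn0.
apply: eq_bigr => j _.
rewrite -mul_polyC -[p`_k`_j in LHS]coefK poly_def.
rewrite rmorph_sum mulr_suml rmorph_sum mulr_suml.
rewrite -(big_mkord xpredT (fun i => ((p`_k`_j`_i *: 'X^i)%:P * 'X^j)%:P * 'X^k)).
rewrite /index_iota subn0.
by apply: eq_bigr => i _; rewrite nested_monoE -mul_polyC.
Qed.

Section Evaluation.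
Variables (B : comNzRingType) (io : {rmorphism K -> B}) (y : 'I_3 -> B).

Let comm_y (D : nzRingType) (f : {rmorphism D -> B}) i : commr_rmorph f (y i).
Proof. by move=> x; apply: mulrC. Qed.

Let ev_poly : {rmorphism {poly {poly {poly K}}} -> B} :=
  horner_morph (comm_y (horner_morph (comm_y (horner_morph (comm_y io 0)) 1%:R)) 2%:R).

Definition nested_ev : R3 -> B := ev_poly.

Lemma nested_ev_is_zmod_morphism : zmod_morphism nested_ev.
Proof. exact: (rmorphB ev_poly). Qed.
Lemma nested_ev_is_monoid_morphism : monoid_morphism nested_ev.
Proof. by split=> [|F G]; [apply: (rmorph1 ev_poly)|apply: (rmorphM ev_poly)]. Qed.
HB.instance Definition _ := GRing.isZmodMorphism.Build R3 B nested_ev nested_ev_is_zmod_morphism.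
HB.instance Definition _ := GRing.isMonoidMorphism.Build R3 B nested_ev nested_ev_is_monoid_morphism.

Lemma nested_ev_cst c : nested_ev (nested_cst c) = io c.
Proof.
by rewrite /nested_ev /nested_cst /const3 /=; do 3 rewrite horner_morphC /=.
Qed.

Lemma nested_ev_var i : nested_ev (nested_var i) = y i.
Proof.
by move: i; apply: ord3_ind; rewrite /nested_ev /= ?nested_var0 ?nested_var1 ?nested_var2
  ?horner_morphC /= ?horner_morphC /= ?horner_morphX.
Qed.

End Evaluation.

Lemma eval3_cst c a : eval3 (nested_cst c) a = c.
Proof. by rewrite /eval3 /nested_cst /const3 !hornerC. Qed.

Lemma eval3_var i a : eval3 (nested_var i) a = a 0 i.
Proof.
by move: i; apply: ord3_ind; rewrite /eval3 ?nested_var0 ?nested_var1 ?nested_var2 ?(hornerC, hornerX).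
Qed.

Lemma eval3D F G a : eval3 (F + G) a = eval3 F a + eval3 G a.
Proof. by rewrite /eval3 (hornerD F) !hornerD. Qed.

Lemma eval3M F G a : eval3 (F * G) a = eval3 F a * eval3 G a.
Proof. by rewrite /eval3 (hornerM F) !hornerM. Qed.

Lemma poly_eq0_closed (p : {poly K}) : (forall x, p.[x] = 0) -> p = 0.
Proof.
move=> h; apply/eqP/negPn/negP => /closed_nonrootP[x].
by rewrite rootE h eqxx.
Qed.

(** The variables are removed one at a time: for fixed [x] and [y] the polynomial in the last
    variable has only zero values, hence zero coefficients; these are then polynomials in [y], and
    finally in [x], to which the same argument applies. *)
Lemma eval3_eq0 F : (forall a, eval3 F a = 0) -> F = 0.
Proof.
move=> h; apply/polyP=> k; rewrite coef0; apply/polyP=> j; rewrite coef0.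
apply: poly_eq0_closed => x.
pose ex := horner_eval x; pose ey y : {poly {poly K}} -> {poly K} := horner_eval y%:P.
have p0 y : map_poly (ex \o ey y) F = 0.
  apply: poly_eq0_closed => z.
  have := h (\row_(i < 3) if i == 0 then x else if i == 1%:R then y else z).
  rewrite /eval3 !mxE /= => <-.
  have ez : (ex \o ey y) z%:P%:P = z by rewrite /= /ex /ey /horner_eval !hornerC.
  by rewrite -{1}ez horner_map.
have q0 : map_poly ex F`_k = 0.
  apply: poly_eq0_closed => y; have -> : y = ex y%:P by rewrite /ex /horner_eval hornerC.
  have /(congr1 (fun p : {poly K} => p`_k)) := p0 y.
  by rewrite horner_map coef_map coef0.
have /(congr1 (fun p : {poly K} => p`_j)) := q0.
by rewrite coef_map coef0.
Qed.

End NestedPolynomials.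

(** * The abstract polynomial ring in three variables *)

Section Interface.
Local Open Scope ring_scope.
Variable K : closedFieldType.

(* The interface of [K[x0, x1, x2]] used below. Working over an abstract domain
   keeps unification from unfolding the three nested polynomial structures. *)
Record poly3 (D : idomainType) := Poly3 {
  p3_cst : {rmorphism K -> D};
  p3_var : 'I_3 -> D;
  p3_coef : D -> nat -> nat -> nat -> K;
  p3_eval : D -> 'rV[K]_3 -> K;
  p3_ev : forall B : comNzRingType, {rmorphism K -> B} -> ('I_3 -> B) -> {rmorphism D -> B};
  p3_coefD : forall F G i j k, p3_coef (F + G) i j k = p3_coef F i j k + p3_coef G i j k;
  p3_coefZ : forall c F i j k, p3_coef (p3_cst c * F) i j k = c * p3_coef F i j k;
  p3_coef_mono : forall c i j k i' j' k',
    p3_coef (p3_cst c * (p3_var 0 ^+ i * p3_var 1%:R ^+ j * p3_var 2%:R ^+ k)) i' j' k' =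
    if [&& i' == i, j' == j & k' == k] then c else 0;
  p3_expand : forall F, exists s : seq (nat * nat * nat),
    F = \sum_(x <- s) p3_cst (p3_coef F x.1.1 x.1.2 x.2) *
          (p3_var 0 ^+ x.1.1 * p3_var 1%:R ^+ x.1.2 * p3_var 2%:R ^+ x.2);
  p3_ev_cst : forall B io y c, @p3_ev B io y (p3_cst c) = io c;
  p3_ev_var : forall B io y i, @p3_ev B io y (p3_var i) = y i;
  p3_eval_cst : forall c a, p3_eval (p3_cst c) a = c;
  p3_eval_var : forall i a, p3_eval (p3_var i) a = a 0 i;
  p3_evalD : forall F G a, p3_eval (F + G) a = p3_eval F a + p3_eval G a;
  p3_evalM : forall F G a, p3_eval (F * G) a = p3_eval F a * p3_eval G a;
  p3_eval_eq0 : forall F, (forall a, p3_eval F a = 0) -> F = 0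
}.

Definition nested_poly3 : poly3 {poly {poly {poly K}}} :=
  @Poly3 {poly {poly {poly K}}} (@nested_cst K) (@nested_var K) (@coef3 K) (@eval3 K)
    (fun B io y => nested_ev io y)
    (@nested_coefD K) (@nested_coefZ K) (@nested_coef_mono K) (@nested_expand K)
    (@nested_ev_cst K) (@nested_ev_var K) (@eval3_cst K) (@eval3_var K) (@eval3D K) (@eval3M K)
    (@eval3_eq0 K).
End Interface.

(** * Homogeneous forms and substitution morphisms *)

Section FatPoints.
Local Open Scope ring_scope.
Variables (K : closedFieldType) (R3 : idomainType) (S : poly3 K R3).
Implicit Types (F G : R3) (a b n : 'rV[K]_3).
Local Notation cst3 := (p3_cst S).
Local Notation xv := (p3_var S).
Local Notation coef3 := (p3_coef S).
Local Notation eva := (p3_eval S).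
Local Notation ev := (@p3_ev K R3 S _).

Definition mono (i j k : nat) : R3 :=
  xv 0 ^+ i * xv 1%:R ^+ j * xv 2%:R ^+ k.

Definition homogeneous (t : nat) F : Prop :=
  forall i j k : nat, coef3 F i j k != 0 -> (i + j + k)%N = t.

Lemma coef3_mono c i j k i' j' k' :
  coef3 (cst3 c * mono i j k) i' j' k' =
  if [&& i' == i, j' == j & k' == k] then c else 0.
Proof. exact: p3_coef_mono. Qed.

Lemma coef3_0 i j k : coef3 0 i j k = 0.
Proof. by have := p3_coefZ S 0 0 i j k; rewrite mulr0 mul0r. Qed.

Lemma homog_ind t (Q : R3 -> Prop) : Q 0 -> (forall F G, Q F -> Q G -> Q (F + G)) ->
  (forall c i j k, (i + j + k)%N = t -> Q (cst3 c * mono i j k)) ->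
  forall F, homogeneous t F -> Q F.
Proof.
move=> Q0 QD Qm F hF; have [s ->] := p3_expand S F.
apply: (big_ind Q) => // -[[i j] k] _ /=.
have [->|nz] := eqVneq (coef3 F i j k) 0; first by rewrite rmorph0 mul0r.
by apply: Qm; apply: hF.
Qed.

Lemma R3_ind (Q : R3 -> Prop) :
  (forall c, Q (cst3 c)) -> (forall i, Q (xv i)) ->
  (forall F G, Q F -> Q G -> Q (F + G)) -> (forall F G, Q F -> Q G -> Q (F * G)) ->
  forall F, Q F.
Proof.
move=> Qc Qx QD QM F; have [s ->] := p3_expand S F.
have Q0 : Q 0 by have := Qc 0; rewrite rmorph0.
have QX i e : Q (xv i ^+ e).
  elim: e => [|e IH]; last by rewrite exprS; apply: QM.
  by have := Qc 1; rewrite rmorph1.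
apply: (big_ind Q) => // -[[i j] k] _; apply: (QM _ _ (Qc _)).
exact: QM (QM _ _ (QX _ _) (QX _ _)) (QX _ _).
Qed.

Section Evaluation.
Variables (B : comNzRingType) (io : {rmorphism K -> B}) (y : 'I_3 -> B).

Lemma ev_unique (g : {rmorphism R3 -> B}) :
  (forall c, g (cst3 c) = io c) -> (forall i, g (xv i) = y i) -> g =1 ev io y.
Proof.
move=> gc gx; apply: R3_ind => [c|i|F G eF eG|F G eF eG].
- by rewrite gc p3_ev_cst.
- by rewrite gx p3_ev_var.
- by rewrite !rmorphD eF eG.
- by rewrite !rmorphM eF eG.
Qed.

Lemma ev_mono c i j k :
  ev io y (cst3 c * mono i j k) = io c * (y 0 ^+ i * y 1%:R ^+ j * y 2%:R ^+ k).
Proof. by rewrite !rmorphM !rmorphXn /= p3_ev_cst !p3_ev_var. Qed.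
End Evaluation.

Lemma ev_comp (B C : comNzRingType) (io : {rmorphism K -> B})
    (g : {rmorphism B -> C}) (y : 'I_3 -> B) F :
  g (ev io y F) = ev (g \o io) (g \o y) F.
Proof.
apply: (@ev_unique _ (g \o io) (g \o y) (g \o ev io y)) => [c|i] /=.
  by rewrite p3_ev_cst.
by rewrite p3_ev_var.
Qed.

Lemma eq_ev (B : comNzRingType) (io io' : {rmorphism K -> B}) (y y' : 'I_3 -> B) F :
  io =1 io' -> y =1 y' -> ev io y F = ev io' y' F.
Proof.
move=> ei ey; apply: (@ev_unique _ io' y' (ev io y)) => [c|i] /=.
  by rewrite p3_ev_cst.
by rewrite p3_ev_var.
Qed.

(** The target ring is arbitrary so that the lemma serves for evaluation at points, for the dilation
    into [{poly R3}] and for the constant term of the Taylor expansion. *)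
Lemma ev_scale (B : comNzRingType) (io : {rmorphism K -> B}) (y : 'I_3 -> B) c t F :
  homogeneous t F -> ev io (fun i => c * y i) F = c ^+ t * ev io y F.
Proof.
move: F; apply: homog_ind => [|F G eF eG|k i j l <-].
- by rewrite !rmorph0 mulr0.
- by rewrite !rmorphD /= eF eG mulrDr.
- by rewrite !ev_mono !exprMn !exprD; ring.
Qed.

Lemma ev_id F : ev cst3 xv F = F.
Proof. by symmetry; apply: (@ev_unique _ cst3 xv idfun). Qed.

Lemma evaE F a : eva F a = ev idfun (a 0) F.
Proof.
move: F; apply: R3_ind => [c|i|F G eF eG|F G eF eG].
- by rewrite p3_eval_cst p3_ev_cst.
- by rewrite p3_eval_var p3_ev_var.
- by rewrite p3_evalD rmorphD eF eG.
- by rewrite p3_evalM rmorphM eF eG.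
Qed.

Lemma eva_scale t F c a : homogeneous t F -> eva F (c *: a) = c ^+ t * eva F a.
Proof.
move=> hF; rewrite !evaE -(ev_scale _ _ _ hF); by apply: eq_ev => // i; rewrite mxE.
Qed.

(** * Ideals and their powers *)

Definition ideal_span (I : R3 -> Prop) F : Prop :=
  exists gs cs : seq R3, size gs = size cs /\
    (forall i, (i < size gs)%N -> I gs`_i) /\
    F = \sum_(i < size gs) cs`_i * gs`_i.

Definition ideal_power (I : R3 -> Prop) (m : nat) : R3 -> Prop :=
  ideal_span (fun g => exists l : seq R3, size l = m /\
                       (forall i, (i < m)%N -> I l`_i) /\ g = \prod_(x <- l) x).

Section Ideals.
Variable I : R3 -> Prop.

Lemma ideal_span_ind (Q : R3 -> Prop) : Q 0 -> (forall F G, Q F -> Q G -> Q (F + G)) ->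
  (forall c g, I g -> Q (c * g)) -> forall F, ideal_span I F -> Q F.
Proof.
move=> Q0 QD QI F [gs [cs [ecs [hgs ->]]]].
by apply: (big_ind Q) => // i _; apply/QI/hgs.
Qed.

Lemma ideal_span_mem g : I g -> ideal_span I g.
Proof.
move=> hg; exists [:: g], [:: 1]; split=> //; split; first by case.
by rewrite big_ord_recl big_ord0 mul1r addr0.
Qed.

Lemma ideal_span0 : ideal_span I 0.
Proof. by exists [::], [::]; rewrite big_ord0. Qed.

Lemma ideal_spanD F G : ideal_span I F -> ideal_span I G -> ideal_span I (F + G).
Proof.
move=> [gs [cs [ecs [hgs ->]]]] [gs' [cs' [ecs' [hgs' ->]]]].
exists (gs ++ gs'), (cs ++ cs'); rewrite !size_cat ecs ecs'; split=> //; split.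
  by move=> i hi; rewrite nth_cat ecs; case: ltnP => h; [apply: hgs|apply: hgs']; lia.
rewrite big_split_ord /=; congr (_ + _); apply: eq_bigr => i _.
  by rewrite !nth_cat ecs ltn_ord.
by rewrite !nth_cat ecs ltnNge leq_addr /= addKn.
Qed.

Lemma ideal_spanM c F : ideal_span I F -> ideal_span I (c * F).
Proof.
move=> [gs [cs [ecs [hgs ->]]]]; exists gs, (map ( *%R c) cs).
rewrite size_map; split=> //; split=> //.
rewrite mulr_sumr; apply: eq_bigr => i _.
by rewrite (nth_map 0) -?ecs // mulrA.
Qed.
End Ideals.

Section Powers.
Variable I : R3 -> Prop.

Lemma ideal_power0 F : ideal_power I 0 F.
Proof.
rewrite -[F]mulr1; apply/ideal_spanM/ideal_span_mem.
by exists [::]; rewrite big_nil.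
Qed.

Lemma ideal_power1 F : I F -> ideal_power I 1 F.
Proof.
move=> hF; apply: ideal_span_mem; exists [:: F]; rewrite big_seq1.
by split=> //; split=> // -[].
Qed.

Lemma ideal_powerM k l F G :
  ideal_power I k F -> ideal_power I l G -> ideal_power I (k + l) (F * G).
Proof.
move: F; apply: ideal_span_ind => [|F F' hF hF' hG|c g [s [es [hs ->]]]].
- by rewrite mul0r; move=> _; apply: ideal_span0.
- by rewrite mulrDl; apply: ideal_spanD; [apply: hF|apply: hF'].
move: G; apply: ideal_span_ind => [|F F' hF hF'|d _ [s' [es' [hs' ->]]]].
- by rewrite mulr0; apply: ideal_span0.
- by rewrite mulrDr; apply: ideal_spanD.
rewrite mulrACA; apply/ideal_spanM/ideal_span_mem; exists (s ++ s').
rewrite size_cat es es' big_cat; split=> //; split=> // i hi.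
by rewrite nth_cat es; case: ltnP => h; [apply: hs|apply: hs']; lia.
Qed.

(** Only the first [k] factors of each product are kept; the others join the coefficient. *)
Lemma ideal_power_leq k l F : (k <= l)%N -> ideal_power I l F -> ideal_power I k F.
Proof.
move=> kl; move: F; apply: ideal_span_ind => [|F G|c _ [s [es [hs ->]]]].
- exact: ideal_span0.
- exact: ideal_spanD.
rewrite -(cat_take_drop k s) big_cat mulrCA mulrC /= .
apply/ideal_spanM/ideal_span_mem; exists (take k s).
rewrite size_takel ?es //; split=> //; split=> // i ik.
by rewrite nth_take //; apply: hs; lia.
Qed.

(* A ring morphism sending [I] into a principal ideal [(z)] sends [I^m] into [(z^m)]. *)
Lemma ideal_power_morph (B : comNzRingType) (g : {rmorphism R3 -> B}) z m F :
  (forall f, I f -> exists q, g f = q * z) ->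
  ideal_power I m F -> exists q, g F = q * z ^+ m.
Proof.
move=> hg; move: F; apply: ideal_span_ind => [|F G [p ep] [q eq]|c _ [s [<- [hs ->]]]].
- by exists 0; rewrite rmorph0 mul0r.
- by exists (p + q); rewrite rmorphD ep eq mulrDl.
suff [q eq] : exists q, g (\prod_(x <- s) x) = q * z ^+ size s.
  by exists (g c * q); rewrite rmorphM eq mulrA.
elim: s hs => [_|f s IH hs]; first by exists 1; rewrite big_nil rmorph1 mulr1.
have [q eq] := IH (fun i hi => hs i.+1 hi).
have [p ep] := hg _ (hs 0%N isT).
by exists (p * q); rewrite big_cons rmorphM ep eq exprS mulrACA.
Qed.
End Powers.

(** * Linear forms and homogeneity *)

Definition dot (u v : 'rV[K]_3) : K := \sum_(i < 3) u 0 i * v 0 i.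
Definition lin (u : 'rV[K]_3) : R3 := \sum_(i < 3) cst3 (u 0 i) * xv i.

Lemma on_lineE (L : pline K) (P : ppoint K) : on_line L P = (dot L P == 0).
Proof. by []. Qed.

Lemma dotC u v : dot u v = dot v u.
Proof. by apply: eq_bigr => i _; rewrite mulrC. Qed.

Lemma dotDr u v w : dot u (v + w) = dot u v + dot u w.
Proof. by rewrite -big_split; apply: eq_bigr => i _; rewrite mxE mulrDr. Qed.

Lemma dotZr c u v : dot u (c *: v) = c * dot u v.
Proof. by rewrite mulr_sumr; apply: eq_bigr => i _; rewrite mxE mulrCA. Qed.

Lemma ev_lin (B : comNzRingType) (io : {rmorphism K -> B}) (y : 'I_3 -> B) u :
  ev io y (lin u) = \sum_(i < 3) io (u 0 i) * y i.
Proof.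
by rewrite rmorph_sum; apply: eq_bigr => i _; rewrite rmorphM /= p3_ev_cst p3_ev_var.
Qed.

Lemma eva_lin u a : eva (lin u) a = dot u a.
Proof. by rewrite evaE ev_lin. Qed.

Lemma homogD t F G : homogeneous t F -> homogeneous t G -> homogeneous t (F + G).
Proof.
move=> hF hG i j k; rewrite p3_coefD => nz.
have [e|] := eqVneq (coef3 F i j k) 0; last exact: hF.
by apply: hG; rewrite e add0r in nz.
Qed.

Lemma homogZ t c F : homogeneous t F -> homogeneous t (cst3 c * F).
Proof.
by move=> hF i j k; rewrite p3_coefZ mulf_eq0 => /norP[_]; apply: hF.
Qed.

Lemma homog0 t : homogeneous t (0 : R3).
Proof. by move=> i j k; rewrite coef3_0 eqxx. Qed.

Lemma homog_mono c i j k : homogeneous (i + j + k) (cst3 c * mono i j k).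
Proof.
move=> i' j' k'; rewrite coef3_mono; case: ifP; last by rewrite eqxx.
by case/and3P=> /eqP-> /eqP-> /eqP->.
Qed.

Lemma homogM t u F G : homogeneous t F -> homogeneous u G -> homogeneous (t + u) (F * G).
Proof.
move: F; apply: homog_ind => [|F F' hF hF' hG|c i j k <-].
- by rewrite mul0r => _; apply: homog0.
- by rewrite mulrDl; apply: homogD; [apply: hF|apply: hF'].
move: G; apply: homog_ind => [|F F' hF hF'|d i' j' k' <-].
- by rewrite mulr0; apply: homog0.
- by rewrite mulrDr; apply: homogD.
have -> : cst3 c * mono i j k * (cst3 d * mono i' j' k') =
   cst3 (c * d) * mono (i + i') (j + j') (k + k').
  by rewrite /mono !exprD rmorphM; ring.
rewrite [X in homogeneous X](_ : _ = (i + i' + (j + j') + (k + k'))%N); last lia.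
exact: homog_mono.
Qed.

Lemma homog_const c : homogeneous 0 (cst3 c).
Proof.
have m1 : mono 0 0 0 = 1.
  by rewrite /mono !expr0 !mulr1.
have e : cst3 c * mono 0 0 0 = cst3 c.
  by rewrite m1 mulr1.
rewrite -[cst3 c]e.
exact: (@homog_mono c 0 0 0).
Qed.

Lemma homog1 : homogeneous 0 (1 : R3).
Proof. by rewrite -(rmorph1 cst3); apply: homog_const. Qed.

Lemma homog_xv i : homogeneous 1 (xv i).
Proof.
move: i; apply: ord3_ind.
- have <- : cst3 1 * mono 1 0 0 = xv 0 by rewrite rmorph1 mul1r /mono !expr0 !mulr1.
  exact: (@homog_mono 1 1 0 0).
- have <- : cst3 1 * mono 0 1 0 = xv 1%:R by rewrite /mono !expr0 rmorph1 !mul1r mulr1.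
  exact: (@homog_mono 1 0 1 0).
- have <- : cst3 1 * mono 0 0 1 = xv 2%:R by rewrite /mono !expr0 rmorph1 !mul1r.
  exact: (@homog_mono 1 0 0 1).
Qed.

Lemma homog_sum t (T : Type) (r : seq T) (f : T -> R3) :
  (forall i, homogeneous t (f i)) -> homogeneous t (\sum_(i <- r) f i).
Proof.
move=> hf; apply: big_ind => [||i _]; [exact: homog0|exact: homogD|exact: hf].
Qed.

Lemma homog_lin u : homogeneous 1 (lin u).
Proof. by apply: homog_sum => i; apply/homogZ/homog_xv. Qed.

Lemma homog_prod_lin (T : Type) (r : seq T) (f : T -> 'rV[K]_3) :
  homogeneous (size r) (\prod_(i <- r) lin (f i)).
Proof.
elim: r => [|i r IH]; rewrite ?big_nil ?big_cons.
  exact: homog1.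
exact: homogM (@homog_lin _) IH.
Qed.

(* [F] is homogeneous of degree [t] iff [F (z x) = z^t F (x)]; in this form
   homogeneity passes to cofactors. *)
Definition dilate : {rmorphism R3 -> {poly R3}} :=
  ev (polyC \o cst3) (fun i => 'X * (xv i)%:P).

Lemma dilate_homog t F : homogeneous t F -> dilate F = 'X^t * F%:P.
Proof.
move=> hF; rewrite /dilate (ev_scale _ _ _ hF); congr (_ * _).
by rewrite -[in RHS](ev_id F) (ev_comp _ polyC).
Qed.

Lemma coef_dilate_mono c i' j' k' d i j k :
  coef3 (dilate (cst3 c * mono i' j' k'))`_d i j k =
  if (i + j + k == d)%N then coef3 (cst3 c * mono i' j' k') i j k else 0.
Proof.
rewrite (dilate_homog (@homog_mono _ _ _ _)) coefXnM coefC; case: ltnP => h.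
  rewrite coef3_0 coef3_mono; case: eqP => // e; case: and3P => // -[].
  by move=> /eqP ei /eqP ej /eqP ek; exfalso; lia.
case: eqP => e; rewrite ?coef3_mono /=.
  case: and3P => [|_]; last by rewrite if_same.
  by move=> [/eqP ei /eqP ej /eqP ek]; case: eqP => // e'; exfalso; lia.
rewrite coef3_0; case: eqP => // e'; case: and3P => // -[].
by move=> /eqP ei /eqP ej /eqP ek; exfalso; lia.
Qed.

(** The coefficient of ['X^d] in the dilation is the homogeneous component of degree [d], which is
    what makes the characterisation of homogeneity an equivalence. *)
Lemma coef_dilate F d i j k :
  coef3 (dilate F)`_d i j k = if (i + j + k == d)%N then coef3 F i j k else 0.
Proof.
pose Q F := coef3 (dilate F)`_d i j k = if (i + j + k == d)%N then coef3 F i j k else 0.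
have Q0 : Q 0 by rewrite /Q rmorph0 coef0 coef3_0 if_same.
have QD F1 F2 : Q F1 -> Q F2 -> Q (F1 + F2).
  by rewrite /Q rmorphD coefD !p3_coefD => -> ->; case: ifP; rewrite ?addr0.
have [s ->] := p3_expand S F; rewrite -/(Q _).
by apply: (big_ind Q) => // x _; apply: coef_dilate_mono.
Qed.

Lemma homog_dilate t F : dilate F = 'X^t * F%:P -> homogeneous t F.
Proof.
move=> e i j k nz; have := coef_dilate F (i + j + k) i j k.
rewrite eqxx e coefXnM coefC; case: ltnP => h.
  by rewrite coef3_0 => e'; rewrite -e' eqxx in nz.
case: eqP => [|_]; first by lia.
by rewrite coef3_0 => e'; rewrite -e' eqxx in nz.
Qed.

(** Dilation is multiplicative, so the nonzero factor ['X^t * F%:P] cancels from the dilation of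
    [F * G]. *)
Lemma homog_cofactor t u F G : F != 0 -> homogeneous t F ->
  homogeneous (t + u) (F * G) -> homogeneous u G.
Proof.
move=> nzF hF /dilate_homog; rewrite rmorphM /= (dilate_homog hF) => e.
apply: homog_dilate; apply: (@mulfI _ ('X^t * F%:P)).
  by rewrite mulf_neq0 ?polyC_eq0 // monic_neq0 ?monicXn.
by rewrite e exprD polyCM; ring.
Qed.

(** * Normalized representatives and point ideals *)

Definition point_ideal (P : ppoint K) : R3 -> Prop :=
  ideal_span (fun g => exists t, homogeneous t g /\ eva g (pval P) = 0).

Lemma pvec_coord (P : pvec K) : exists k, pval P 0 k = 1.
Proof.
case: P => P /=; rewrite /normalized.
case/orP => [/orP[/eqP e|/andP[_ /eqP e]]|/and3P[_ _ /eqP e]]; by eexists; exact: e.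
Qed.

Lemma pvec_neq0 (P : pvec K) : pval P != 0.
Proof.
have [k e] := pvec_coord P; apply/eqP=> /matrixP/(_ 0 k)/eqP.
by rewrite e mxE oner_eq0.
Qed.

(** Since [c] is nonzero, both vectors have their first nonzero coordinate at the same index; it
    equals 1 in both, which forces [c = 1]. *)
Lemma pvec_prop (P Q : pvec K) c : pval P = c *: pval Q -> P = Q.
Proof.
move=> e; apply/val_inj => /=; have c0 : c != 0.
  by apply/eqP => c0; have := pvec_neq0 P; rewrite e c0 scale0r eqxx.
suff c1 : c = 1 by rewrite e c1 scale1r.
have eq i : pval P 0 i = c * pval Q 0 i by rewrite e mxE.
have [e0 e1 e2] := And3 (eq 0) (eq 1%:R) (eq 2%:R).
move: P Q {e eq} e0 e1 e2 => [P nP] [Q nQ] /=.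
case/orP: nP => [/orP[/eqP e|/andP[/eqP e0 /eqP e]]|/and3P[/eqP e0 /eqP e1 /eqP e]];
case/orP: nQ => [/orP[/eqP f|/andP[/eqP f0 /eqP f]]|/and3P[/eqP f0 /eqP f1 /eqP f]];
rewrite ?e ?e0 ?e1 ?f ?f0 ?f1 ?mulr1 ?mulr0 => h0 h1 h2 //;
by first [move/eqP: h0; rewrite oner_eq0 | move/eqP: h1; rewrite oner_eq0
         | rewrite -h0 eqxx in c0 | rewrite -h1 eqxx in c0].
Qed.

Lemma horner_affine (D : comNzRingType) (u v x : D) : (u%:P + 'X * v%:P).[x] = u + x * v.
Proof. by rewrite hornerD hornerM hornerX !hornerC. Qed.

(** * Vanishing order at a point *)

Section Taylor.
Variables (P : ppoint K) (k : 'I_3).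
Hypothesis Pk : pval P 0 k = 1.
Local Notation IP := (point_ideal P).

(** These linear forms vanish at [P] because [Pk] makes coordinate [k] equal to 1. *)
Let shift i : R3 := xv i - cst3 (pval P 0 i) * xv k.

(* [F (x_k P + z (x - x_k P))], a polynomial in [z] whose value at [z = 1] is [F]. *)
Definition taylor : {rmorphism R3 -> {poly R3}} :=
  ev (polyC \o cst3) (fun i => (cst3 (pval P 0 i) * xv k)%:P + 'X * (shift i)%:P).

Lemma taylor1 F : (taylor F).[1] = F.
Proof.
rewrite -[RHS]ev_id; apply: etrans (ev_comp _ (horner_eval 1) _ F) _.
apply: eq_ev => [c|i] /=; first exact: hornerC.
by rewrite /horner_eval horner_affine mul1r addrC subrK.
Qed.

(** At [z = 0] the substituted point is [x_k P], and homogeneity extracts the power of [x_k]. *)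
Lemma taylor0 t F : homogeneous t F -> (taylor F).[0] = xv k ^+ t * cst3 (eva F (pval P)).
Proof.
move=> hF; apply: etrans (ev_comp _ (horner_eval 0) _ F) _.
rewrite evaE (ev_comp idfun cst3) -(ev_scale _ _ _ hF).
apply: eq_ev => [c|i] /=; first exact: hornerC.
by rewrite /horner_eval horner_affine mul0r addr0 mulrC.
Qed.

Lemma shift_mem i : ideal_power IP 1 (shift i).
Proof.
apply/ideal_power1/ideal_span_mem; exists 1%N; split.
  rewrite /shift -mulNr -rmorphN.
  apply: homogD; first exact: homog_xv.
  apply: homogZ; exact: homog_xv.
by rewrite evaE rmorphB rmorphM /= p3_ev_cst !p3_ev_var /= Pk mulr1 subrr.
Qed.

(** Each factor ['X] enters the expansion together with a form [shift i] of the ideal. The property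
    passes to sums and products, so checking constants and variables is enough. *)
Lemma coef_taylor F j : ideal_power IP j (taylor F)`_j.
Proof.
have I0 m : ideal_power IP m 0 by exact: ideal_span0.
move: F j; apply: R3_ind => [c|i|F G hF hG|F G hF hG] j.
- rewrite /taylor p3_ev_cst /= coefC; case: j => [|j] //=; exact: ideal_power0.
- rewrite /taylor p3_ev_var coefD coefC coefXM coefC.
  case: j => [|[|j]] /=; rewrite ?addr0 ?add0r //; first exact: ideal_power0.
  exact: shift_mem.
- rewrite rmorphD coefD; exact: ideal_spanD (hF j) (hG j).
- rewrite rmorphM coefM; apply: (big_ind (ideal_power IP j)) => //.
    exact: ideal_spanD.
  move=> i _; have {1}-> : j = (i + (j - i))%N by rewrite subnKC // -ltnS.
  exact: ideal_powerM (hF i) (hG _).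
Qed.

(** Membership in a power of the ideal becomes divisibility by a power of ['X]. A generator of the
    ideal has a Taylor expansion vanishing at 0, which gives one direction. Conversely [F] is the
    sum of the coefficients, where those below [m] are 0 and the one of index [j >= m] lies in the
    [j]-th power of the ideal. *)
Lemma ideal_power_ptP m F :
  ideal_power IP m F <-> exists q, taylor F = q * 'X^m.
Proof.
split.
  apply: ideal_power_morph; apply: ideal_span_ind.
  - by exists 0; rewrite rmorph0 mul0r.
  - by move=> F1 F2 [p ep] [q eq]; exists (p + q); rewrite rmorphD /= ep eq mulrDl.
  move=> c g [t [hg g0]].
  have /factor_theorem[q] : root (taylor g) 0.
    by rewrite rootE (taylor0 hg) g0 rmorph0 mulr0.
  by rewrite subr0 => e; exists (taylor c * q); rewrite rmorphM /= e mulrA.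
case=> q e; rewrite -[F]taylor1 horner_coef; apply: (big_ind (ideal_power IP m)).
- exact: ideal_span0.
- by move=> F1 F2; apply: ideal_spanD.
move=> i _; rewrite expr1n mulr1; move: (nat_of_ord i) => {}i.
have [im|mi] := ltnP i m; first by rewrite e coefMXn im; apply: ideal_span0.
exact: ideal_power_leq mi (coef_taylor _ _).
Qed.
End Taylor.

(** The polynomial ['X] is prime and does not divide [p], so its factors are moved into [r] one by
    one. *)
Lemma Xn_cofactor (D : idomainType) (p r q : {poly D}) m :
  p.[0] != 0 -> p * r = q * 'X^m -> exists q', r = q' * 'X^m.
Proof.
move=> p0; elim: m r => [|m IH] r; first by exists r; rewrite mulr1.
rewrite exprSr mulrA => e; have /factor_theorem[r1] : root r 0.
  have := congr1 (horner_eval 0) e; rewrite /horner_eval !hornerM hornerX !mulr0.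
  by move/eqP; rewrite mulf_eq0 (negPf p0).
rewrite subr0 => e1; rewrite e1 mulrA in e *.
have [|q' ->] := IH r1; last by exists q'; rewrite -mulrA -exprSr.
by apply: mulIf e; rewrite polyX_eq0.
Qed.

(** A line missing [P] has a Taylor expansion with nonzero constant term, so it contributes nothing
    to the vanishing order. This allows division by the equation of the generic line. *)
Lemma ideal_power_cofactor (P : ppoint K) n m F :
  dot n (pval P) != 0 -> ideal_power (point_ideal P) m (lin n * F) ->
  ideal_power (point_ideal P) m F.
Proof.
move=> nP; have [k Pk] := pvec_coord P.
case/(ideal_power_ptP Pk) => q; rewrite rmorphM /= => e.
apply/(ideal_power_ptP Pk); apply: Xn_cofactor e.
rewrite (taylor0 _ _ (@homog_lin n)) eva_lin mulf_neq0 ?expf_neq0 ?fmorph_eq0 //.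
(* A variable is nonzero since its value at the all-ones vector is 1. *)
apply/eqP => x0; have := p3_eval_var S k (const_mx 1).
by rewrite x0 evaE rmorph0 mxE => /eqP; rewrite eq_sym oner_eq0.
Qed.

(** The substitution [proj] is the projection onto the plane [dot n a = 0] along a vector [c] with
    [dot n c = 1]. It changes a polynomial only by a multiple of [lin n], and it kills [F] because
    [F] is zero on that plane. *)
Lemma lin_dvd n F : n != 0 -> (forall a, dot n a = 0 -> eva F a = 0) ->
  exists G, F = lin n * G.
Proof.
move=> n0 hF; have [c nc] : exists c, dot n c = 1.
  have /rV0Pn[i ni] := n0; exists ((n 0 i)^-1 *: delta_mx 0 i).
  rewrite dotZr /dot (bigD1 i) //= big1 => [|j ji]; last first.
    by rewrite mxE (negPf ji) andbF mulr0.
  by rewrite mxE !eqxx mulr1 addr0 mulVf.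
pose proj := ev cst3 (fun i => xv i - lin n * cst3 (c 0 i)).
have modn G : exists H, G = proj G + lin n * H.
  move: G; apply: R3_ind => [d|i|F1 F2 [H1 e1] [H2 e2]|F1 F2 [H1 e1] [H2 e2]].
  - by exists 0; rewrite /proj p3_ev_cst mulr0 addr0.
  - by exists (cst3 (c 0 i)); rewrite /proj p3_ev_var subrK.
  - exists (H1 + H2); rewrite [proj _]rmorphD /= {1}e1 {1}e2 mulrDr.
    by rewrite addrACA.
  - exists (proj F1 * H2 + H1 * F2); rewrite [proj _]rmorphM /= -/proj.
    rewrite {1}e1 mulrDl {1}e2; ring.
have [G e] := modn F; exists G; rewrite {1}e [proj F](p3_eval_eq0 (p := S)) ?add0r // => a.
rewrite evaE /proj ev_comp -(hF (a - dot n a *: c)); last first.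
  by rewrite -scaleNr dotDr dotZr nc mulr1 subrr.
rewrite evaE; apply: eq_ev => [d|i] /=; first by rewrite p3_ev_cst.
by rewrite rmorphB rmorphM /= p3_ev_var p3_ev_cst ev_lin /= !mxE.
Qed.

(** * Restriction to a line *)

Lemma size_mul_le (p q : {poly K}) i j :
  (size p <= i.+1)%N -> (size q <= j.+1)%N -> (size (p * q)%R <= (i + j).+1)%N.
Proof. by have := size_polyMleq p q; lia. Qed.

Section Restriction.
Variables A B : 'rV[K]_3.

(* The dehomogenised restriction [F (A + X B)] to the line through [A] and [B]. *)
Definition restr : {rmorphism R3 -> {poly K}} :=
  ev polyC (fun i => (A 0 i)%:P + (B 0 i)%:P * 'X).

Lemma horner_restr F w : (restr F).[w] = eva F (A + w *: B).
Proof.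
rewrite evaE; apply: etrans (ev_comp _ (horner_eval w) _ F) _.
apply: eq_ev => [c|i] /=; rewrite /horner_eval; first by rewrite hornerC.
by rewrite hornerD hornerM hornerX !hornerC !mxE mulrC.
Qed.

Lemma restr_const c : restr (cst3 c) = c%:P.
Proof. exact: p3_ev_cst. Qed.

Lemma restr_lin n : restr (lin n) = (dot n A)%:P + (dot n B)%:P * 'X.
Proof.
rewrite /restr ev_lin /dot !rmorph_sum mulr_suml -big_split.
by apply: eq_bigr => i _ /=; rewrite !polyCM mulrDr mulrA.
Qed.

Lemma size_restr t F : homogeneous t F -> (size (restr F) <= t.+1)%N.
Proof.
move: F; apply: homog_ind => [|F G hF hG|c i j k <-].
- by rewrite rmorph0 size_poly0.
- rewrite rmorphD; apply: leq_trans (size_polyD _ _) _.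
  by rewrite geq_max hF hG.
have sX l e : (size (((A 0 l)%:P + (B 0 l)%:P * 'X) ^+ e)%R <= e.+1)%N.
  apply: leq_trans (size_poly_exp_leq _ _) _; rewrite ltnS.
  set s := size _; have : (s <= 2)%N.
    rewrite /s addrC size_MXaddC.
    by case: ifP => // _; rewrite ltnS size_polyC leq_b1.
  by case: s => [|[|[|]]] //=; lia.
rewrite /restr ev_mono; set p := (_ ^+ i)%R; set q := (_ ^+ j)%R; set r := (_ ^+ k)%R.
have hp : (size p <= i.+1)%N by exact: sX.
have hq : (size q <= j.+1)%N by exact: sX.
have hr : (size r <= k.+1)%N by exact: sX.
rewrite mul_polyC; apply: leq_trans (size_scale_leq _ _) _.
exact: size_mul_le (size_mul_le hp hq) hr.
Qed.
End Restriction.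

(** The restriction sees only the points [A + w B]; homogeneity extends the vanishing to all
    [z A + w B] with [z] nonzero. The remaining multiples of [B] are reached by exchanging the roles
    of [A] and [B]: the polynomial in [z] is zero after multiplication by ['X], hence zero. *)
Lemma restr_eq0 t A B F u v : homogeneous t F -> restr A B F = 0 ->
  eva F (u *: A + v *: B) = 0.
Proof.
move=> hF r0; have nz z w : z != 0 -> eva F (z *: A + w *: B) = 0.
  move=> z0; have -> : z *: A + w *: B = z *: (A + (w / z) *: B).
    by rewrite scalerDr scalerA mulrCA mulfV ?mulr1.
  by rewrite (eva_scale _ _ hF) -horner_restr r0 horner0 mulr0.
have /eqP : 'X * restr (v *: B) A F = 0.
  apply: poly_eq0_closed => z; rewrite hornerM hornerX horner_restr addrC.
  by have [->|z0] := eqVneq z 0; [rewrite mul0r|rewrite nz ?mulr0].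
rewrite mulf_eq0 polyX_eq0 /= => /eqP e.
by rewrite addrC -horner_restr e horner0.
Qed.

Lemma dot_mx n a : a *m n^T = (dot n a)%:M.
Proof.
apply/matrixP=> i j; rewrite !ord1 !mxE eqxx mulr1n; apply: eq_bigr => k _.
by rewrite mxE mulrC.
Qed.

(** The span of [a] and [b] strictly contains that of [b], so it has rank at least 2, the rank of
    the plane orthogonal to [n]. *)
Lemma plane_span n a b p : n != 0 -> dot n a = 0 -> dot n b = 0 -> dot n p = 0 ->
  b != 0 -> ~~ (a <= b)%MS -> exists u v, p = u *: a + v *: b.
Proof.
move=> n0 na nb np b0 nab.
have sub q : dot n q = 0 -> (q <= kermx n^T)%MS.
  by move=> e; apply/sub_kermxP; rewrite dot_mx e raddf0.
have sab : (a + b <= kermx n^T)%MS by rewrite addsmx_sub !sub.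
have ltb : (b < a + b)%MS by rewrite ltmxE addsmxSr addsmx_sub submx_refl andbT.
have rab : (kermx n^T <= a + b)%MS.
  rewrite -(geq_leqif (mxrank_leqif_sup sab)) mxrank_ker mxrank_tr rank_rV n0.
  by move: ltb; rewrite ltmxErank rank_rV b0 => /andP[].
have /sub_addsmxP[[u v] /= ->] := submx_trans (sub _ np) rab.
exists (u 0 0), (v 0 0); rewrite [u]mx11_scalar [v]mx11_scalar !mul_scalar_mx.
by rewrite !mxE eqxx !mulr1n.
Qed.
(** * Dimensions *)

Lemma var_neq0 i : xv i != 0.
Proof.
apply/eqP => x0; have := p3_eval_var S i (const_mx 1).
by rewrite x0 evaE rmorph0 mxE => /eqP; rewrite eq_sym oner_eq0.
Qed.

Definition indep d (f : 'I_d -> R3) : Prop :=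
  forall c : 'I_d -> K, \sum_i cst3 (c i) * f i = 0 -> forall i, c i = 0.

Definition dim_is (V : R3 -> Prop) (d : nat) : Prop :=
  (exists f : 'I_d -> R3, (forall i, V (f i)) /\ indep f) /\
  (forall f : 'I_d.+1 -> R3, (forall i, V (f i)) -> ~ indep f).

Definition subspace (V : R3 -> Prop) : Prop :=
  V 0 /\ (forall F G, V F -> V G -> V (F + G)) /\ (forall c F, V F -> V (cst3 c * F)).

(** The dimension is the largest size of an independent family in [V], found by descending from [d];
    whether a family of given size exists is decided classically. *)
Lemma dim_sub (V W : R3 -> Prop) d : (forall F, V F -> W F) -> dim_is W d ->
  exists2 d', (d' <= d)%N & dim_is V d'.
Proof.
move=> VW [_ hW]; pose P e := exists f : 'I_e -> R3, (forall i, V (f i)) /\ indep f.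
have P0 : P 0%N by exists (fun=> 0); split=> [[]|c _ []].
have NP : ~ P d.+1 by case=> f [hf]; apply: hW => i; apply/VW/hf.
clear -P0 NP; elim: d NP => [|d IH] NP.
  by exists 0%N => //; split=> // f hf hi; apply: NP; exists f.
have [Pd|/IH[e le he]] := classic (P d.+1); last by exists e => //; apply: leqW.
by exists d.+1 => //; split=> // f hf hi; apply: NP; exists f.
Qed.

(* [V0 -> V -> K^e -> 0], the first map being multiplication by [mu]. *)
Section ExactSequence.
Variables (V V0 : R3 -> Prop) (mu : R3) (e d : nat) (phi : R3 -> 'rV[K]_e).
Hypotheses (mu0 : mu != 0) (Vsub : subspace V).
Hypothesis phiD : forall F G, phi (F + G) = phi F + phi G.
Hypothesis phiZ : forall c F, phi (cst3 c * F) = c *: phi F.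
Hypothesis V0V : forall F, V0 F -> V (mu * F) /\ phi (mu * F) = 0.
Hypothesis kerV : forall F, V F -> phi F = 0 -> exists2 G, V0 G & F = mu * G.
Hypothesis imV : forall i, exists2 F, V F & phi F = delta_mx 0 i.

Let phi_sum (I : finType) (c : I -> K) (f : I -> R3) :
  phi (\sum_i cst3 (c i) * f i) = \sum_i c i *: phi (f i).
Proof.
apply: (big_ind2 (fun x y => phi x = y)) => [|x y x' y' <- <-|i _] //.
by have := phiZ 0 0; rewrite mulr0 scale0r.
Qed.

Let V_sum (I : finType) (c : I -> K) (f : I -> R3) :
  (forall i, V (f i)) -> V (\sum_i cst3 (c i) * f i).
Proof.
have [h0 [hD hZ]] := Vsub; move=> hf.
by apply: (big_ind V) => // i _; apply: hZ.
Qed.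

(** A basis of [V0] multiplied by [mu], together with lifts of the unit vectors, is independent.
    Conversely, among [d + e + 1] elements of [V] the relations between their images in [K^e] form a
    space of dimension at least [d + 1]; the corresponding combinations are [mu] times elements of
    [V0], which satisfy a relation by maximality of [d]. *)
Lemma dim_exact : dim_is V0 d -> dim_is V (d + e).
Proof.
move=> [[f0 [hf0 i0]] max0]; split.
  have /fin_all_exists[g hg] : forall i : 'I_e, exists F, V F /\ phi F = delta_mx 0 i.
    by move=> i; have [F] := imV i; exists F.
  exists (fun i => match split i with inl j => mu * f0 j | inr j => g j end); split.
    by move=> i; case: (split i) => j; [case: (V0V (hf0 j))|case: (hg j)].
  move=> c; rewrite big_split_ord /=.
  under eq_bigr => j _ do rewrite -[lshift e j]/(unsplit (inl j)) unsplitK.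
  under [X in _ + X]eq_bigr => j _ do rewrite -[rshift d j]/(unsplit (inr j)) unsplitK.
  move=> sum0; have cr j : c (rshift d j) = 0.
    have := congr1 phi sum0; rewrite phiD !phi_sum big1 => [|i _]; last first.
      by have [_ ->] := V0V (hf0 i); rewrite scaler0.
    rewrite add0r -[phi 0](_ : 0 = _); last first.
      by have := phiZ 0 0; rewrite mulr0 scale0r.
    move/matrixP/(_ 0 j); rewrite summxE (bigD1 j) //= big1 => [|i ij].
      by rewrite (hg j).2 !mxE !eqxx mulr1 addr0.
    by rewrite (hg i).2 !mxE eqxx eq_sym (negPf ij) mulr0.
  have cl j : c (lshift e j) = 0.
    apply: (i0 (fun j => c (lshift e j))); apply: (mulfI mu0); rewrite mulr0 -[RHS]sum0.
    rewrite [X in _ + X]big1 ?addr0 => [|i _]; last by rewrite cr rmorph0 mul0r.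
    by rewrite mulr_sumr; apply: eq_bigr => i _; rewrite mulrCA.
  by move=> i; rewrite -(splitK i); case: (split i) => j; [apply: cl|apply: cr].
move=> f hf fi; pose M := \matrix_i phi (f i).
pose r := \rank (kermx M).
have dr : (d.+1 <= r)%N.
  by rewrite /r mxrank_ker; have := rank_leq_col M; lia.
(* The partial identity selects [d + 1] rows of a basis of the left kernel. *)
pose C := (pid_mx d.+1 : 'M[K]_(d.+1, r)) *m row_base (kermx M).
have Cfree : row_free C.
  rewrite /row_free /C mxrankMfree ?row_base_free // rank_pid_mx //.
have CM : C *m M = 0.
  have /sub_kermxP : (C <= kermx M)%MS by rewrite (submx_trans (submxMl _ _)) ?eq_row_base.
  by [].
have Ga (k : 'I_d.+1) : exists2 F', V0 F' & \sum_i cst3 (C k i) * f i = mu * F'.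
  apply: kerV; first exact: V_sum.
  rewrite phi_sum; transitivity (row k (C *m M)); last by rewrite CM row0.
  apply/rowP=> j; rewrite summxE !mxE; apply: eq_bigr => i _.
  by rewrite !mxE.
have /fin_all_exists[g hg] : forall k : 'I_d.+1, exists F',
    V0 F' /\ \sum_i cst3 (C k i) * f i = mu * F'.
  by move=> k; have [F'] := Ga k; exists F'.
apply: (max0 g) => [k|c gc k]; first by case: (hg k).
have cC : (\row_k c k) *m C = 0.
  apply/rowP=> i; rewrite mxE [RHS]mxE; move: i.
  apply: fi; transitivity (mu * \sum_k cst3 (c k) * g k); last by rewrite gc mulr0.
  rewrite mulr_sumr.
  under [RHS]eq_bigr => b _ do rewrite mulrCA -(hg b).2 mulr_sumr.
  rewrite exchange_big; apply: eq_bigr => i _ /=.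
  rewrite rmorph_sum mulr_suml; apply: eq_bigr => b _.
  by rewrite !mxE rmorphM mulrA.
have /eqP := cC; rewrite mulmx_free_eq0 // => /eqP/rowP/(_ k).
by rewrite !mxE.
Qed.
End ExactSequence.

Lemma homogeneous_subspace t : subspace (homogeneous t).
Proof.
by split; [exact: homog0|split; [move=> F G; apply: homogD|move=> c F; apply: homogZ]].
Qed.

Lemma dim_homog0 : dim_is (homogeneous 0) 1.
Proof.
rewrite -[1%N]add0n.
apply: (@dim_exact _ (fun F => F = 0) 1 _ _ (fun F => \row_(j < 1) coef3 F 0%N 0%N 0%N)).
- exact: oner_neq0.
- exact: homogeneous_subspace.
- by move=> F G; apply/rowP=> j; rewrite !mxE p3_coefD.
- by move=> c F; apply/rowP=> j; rewrite !mxE p3_coefZ.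
- move=> _ ->; rewrite mulr0; split; first exact: homog0.
  by apply/rowP=> j; rewrite !mxE coef3_0.
- move=> F hF /rowP/(_ 0); rewrite !mxE => F0; exists 0; rewrite ?mulr0 //.
  have [s ->] := p3_expand S F; apply: big1 => x _.
  have [->|nz] := eqVneq (coef3 F x.1.1 x.1.2 x.2) 0; first by rewrite rmorph0 mul0r.
  have := hF _ _ _ nz; move: nz.
  by case: x => -[[|i] [|j]] [|k] //=; rewrite F0 eqxx.
- move=> i; exists (cst3 1); first exact: homog_const.
  apply/rowP=> j; rewrite !mxE !ord1 /= -[cst3 1]mulr1.
  by have := coef3_mono 1 0 0 0 0%N 0%N 0%N; rewrite /mono !expr0 !mulr1.
- split; first by exists (fun=> 0); split=> // c _ [].
  move=> f f0 h; have sum0 : \sum_i cst3 1 * f i = 0.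
    by apply: big1 => i _; rewrite f0 mulr0.
  by have /eqP := h (fun=> 1) sum0 ord0; rewrite oner_eq0.
Qed.

(** The exact sequence is multiplication by the last variable followed by reading the [t + 2]
    coefficients of the monomials free of that variable. *)
Lemma dim_homogS t d : dim_is (homogeneous t) d -> dim_is (homogeneous t.+1) (d + t.+2).
Proof.
apply: (@dim_exact _ _ (xv 2%:R) _ _ (fun F => \row_(j < t.+2) coef3 F (t.+1 - j)%N j 0%N)).
- exact: var_neq0.
- exact: homogeneous_subspace.
- by move=> F G; apply/rowP=> j; rewrite !mxE p3_coefD.
- by move=> c F; apply/rowP=> j; rewrite !mxE p3_coefZ.
- move=> F hF; split; first exact: (homogM (@homog_xv 2%:R) hF).
  apply/rowP=> j; rewrite !mxE; move: (t.+1 - j)%N => i; move: (nat_of_ord j) => {}j.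
  have [s ->] := p3_expand S F; rewrite mulr_sumr.
  apply: (big_ind (fun G => coef3 G i j 0%N = 0)) => [|G H eG eH|x _].
  + exact: coef3_0.
  + by rewrite p3_coefD eG eH addr0.
  rewrite [X in coef3 X](_ : _ = cst3 (coef3 F x.1.1 x.1.2 x.2) * mono x.1.1 x.1.2 x.2.+1).
    by rewrite coef3_mono !andbF.
  by rewrite /mono exprS; ring.
- move=> F hF phiF.
  have [G eF] : exists G, F = xv 2%:R * G.
    have [s ->] := p3_expand S F.
    apply: (big_ind (fun F => exists G, F = xv 2%:R * G)) => [|G H [G' ->] [H' ->]|].
    + by exists 0; rewrite mulr0.
    + by exists (G' + H'); rewrite mulrDr.
    move=> [[i j] k] _ /=.
    have [->|nz] := eqVneq (coef3 F i j k) 0.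
      by exists 0; rewrite rmorph0 mul0r mulr0.
    case: k nz => [|k] nz; last first.
      by exists (cst3 (coef3 F i j k.+1) * (xv 0 ^+ i * xv 1%:R ^+ j * xv 2%:R ^+ k));
         rewrite exprS; ring.
    have e := hF _ _ _ nz; have jt : (j < t.+2)%N by lia.
    have /rowP/(_ (Ordinal jt)) := phiF; rewrite !mxE /=.
    have -> : (t.+1 - j)%N = i by lia.
    by move=> e0; rewrite e0 eqxx in nz.
  exists G => //; apply: (homog_cofactor (var_neq0 2%:R) (@homog_xv 2%:R)).
  by rewrite -eF.
- move=> j; exists (cst3 1 * mono (t.+1 - j) j 0).
    have e : (t.+1 - j + j + 0)%N = t.+1 by have := ltn_ord j; lia.
    by have := @homog_mono 1 (t.+1 - j) j 0; rewrite e.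
  apply/rowP=> i; rewrite !mxE coef3_mono !eqxx andbT /= andbC.
  have [->|nij] := eqVneq i j; first by rewrite !eqxx.
  by rewrite -val_eqE /= in nij; rewrite (negPf nij).
Qed.

Lemma dim_homog_ex t : exists d, dim_is (homogeneous t) d.
Proof.
elim: t => [|t [d hd]]; first by exists 1%N; apply: dim_homog0.
by exists (d + t.+2)%N; apply: dim_homogS.
Qed.
(** * Points and lines *)

Lemma dot_delta u i : dot u (delta_mx 0 i) = u 0 i.
Proof.
rewrite /dot (bigD1 i) //= big1 => [|j ji]; last by rewrite mxE (negPf ji) andbF mulr0.
by rewrite mxE !eqxx mulr1 addr0.
Qed.

(** Two distinct lines through [P] span all linear forms vanishing at [P], so each such form also
    vanishes at [Q]. *)
Lemma line_meet (L1 L2 : pline K) (P Q : ppoint K) : L1 != L2 ->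
  on_line L1 P -> on_line L2 P -> on_line L1 Q -> on_line L2 Q -> P = Q.
Proof.
rewrite !on_lineE => L12 /eqP P1 /eqP P2 /eqP Q1 /eqP Q2.
have perp p : dot (pval P) p = 0 -> dot (pval Q) p = 0.
  move=> Pp; have [||||||u [v ->]] // := @plane_span (pval P) (pval L1) (pval L2) p.
  - exact: pvec_neq0.
  - by rewrite dotC.
  - by rewrite dotC.
  - exact: pvec_neq0.
  - by apply: contra L12 => /sub_rVP[c] /pvec_prop ->.
  by rewrite dotDr !dotZr ![dot (pval Q) _]dotC Q1 Q2 !mulr0 addr0.
have [k Pk] := pvec_coord P.
apply/esym/(@pvec_prop _ _ (pval Q 0 k))/rowP => i; rewrite mxE.
(* This form vanishes at [P] since coordinate [k] of [P] is 1; at [Q] it yields that [Q] is its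
   coordinate [k] times [P]. *)
have := perp (delta_mx 0 i - pval P 0 i *: delta_mx 0 k).
rewrite -scaleNr !dotDr !dotZr !dot_delta Pk mulr1 subrr => /(_ erefl) /eqP.
by rewrite mulNr subr_eq0 mulrC => /eqP.
Qed.

Lemma count_line_meet (X : seq (ppoint K)) (L1 L2 : pline K) : uniq X -> L1 != L2 ->
  (count (fun P => on_line L1 P && on_line L2 P) X <= 1)%N.
Proof.
move=> uX L12; rewrite -size_filter; set Y := filter _ _.
have uY : uniq Y by rewrite filter_uniq.
have : {in Y &, forall P Q, P = Q}.
  move=> P Q; rewrite !mem_filter => /andP[/andP[P1 P2] _] /andP[/andP[Q1 Q2] _].
  exact: line_meet L12 P1 P2 Q1 Q2.
case: Y uY => [|P [|Q Y]] //=; rewrite inE negb_or => /andP[/andP[/eqP PQ _] _] h.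
by case: PQ; apply: h; rewrite !inE eqxx ?orbT.
Qed.

(* Line number [i] adds at least [s - i] new points, as it meets each of the
   previous lines in at most one point. *)
Lemma count_cover (X : seq (ppoint K)) (ls : seq (pline K)) s : uniq X -> uniq ls ->
  {in ls, forall L, count (on_line L) X = s} ->
  (\sum_(i < size ls) (s - i) <= count (fun P => has (fun L => on_line L P) ls) X)%N.
Proof.
move=> uX; elim: ls => [|L ls IH] /=; first by rewrite big_ord0.
case/andP=> Lls uls hs; rewrite big_ord_recr /=.
have := IH uls (fun L' h => hs L' (mem_behead (s := L :: ls) h)).
(* The subtraction [s - i] is truncated; this bound settles the case of more than [s] previous
   lines. *)
have : (count (fun P => on_line L P && has (fun L' => on_line L' P) ls) X <= s)%N.
  by rewrite -(hs L (mem_head _ _)); apply: sub_count => P /andP[].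
have := count_predUI (on_line L) (fun P => has (fun L' => on_line L' P) ls) X.
rewrite hs ?mem_head // /predU /predI /=.
have : (count (fun P => on_line L P && has (fun L' => on_line L' P) ls) X <= size ls)%N.
  elim: ls Lls {IH uls hs} => [|L' ls IH] /=.
    by move=> _; rewrite (eq_count (a2 := pred0)) ?count_pred0 // => P; rewrite andbF.
  rewrite inE negb_or => /andP[LL' /IH {}IH].
  have := count_line_meet uX LL'.
  have := count_predUI (fun P => on_line L P && on_line L' P)
    (fun P => on_line L P && has (fun L' => on_line L' P) ls) X.
  rewrite (eq_count (a1 := predU _ _)
    (a2 := fun P => on_line L P && (on_line L' P || has (fun L' => on_line L' P) ls))).
    by move: IH; lia.
  by move=> P; rewrite /= andb_orr.
set c1 := count (fun x => _ && _) X; set c2 := count (fun x => _ || _) X.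
by set c3 := count _ X; lia.
Qed.

Lemma kconfig_size (X : seq (ppoint K)) s :
  kconfig X (iota 1 s) -> (size X <= \sum_(i < s) i.+1)%N.
Proof.
move=> [uX [_ [_ [Xs [Ls [_ [hXs [_ hX]]]]]]]].
have sub : {subset X <= flatten [seq Xs i | i <- enum 'I_(size (iota 1 s))]}.
  move=> P /hX[i Pi]; apply/flattenP; exists (Xs i) => //.
  by apply: map_f; rewrite mem_enum.
apply: leq_trans (uniq_leq_size uX sub) _.
rewrite size_flatten /shape -map_comp sumnE big_map big_enum /=.
rewrite (eq_bigr (fun i : 'I_(size (iota 1 s)) => i.+1)) ?size_iota // => i _.
rewrite (hXs i).2.1 nth_iota //; have := ltn_ord i.
by rewrite {2}size_iota.
Qed.

(** The [s] lines other than [L] cover at least [s + ... + 1] points, which is already all of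
    [X]. *)
Lemma two_lines (X : seq (ppoint K)) (ls : seq (pline K)) s :
  uniq X -> (size X <= \sum_(i < s) i.+1)%N -> uniq ls -> size ls = s.+1 ->
  {in ls, forall L, count (on_line L) X = s} ->
  {in X & ls, forall P L, exists2 L', L' \in rem L ls & on_line L' P}.
Proof.
move=> uX sX uls sls hs P L PX Lls.
have hr : {in rem L ls, forall L, count (on_line L) X = s}.
  by move=> L' /mem_rem; apply: hs.
have := count_cover uX (rem_uniq L uls) hr.
(* Reversing the index turns the terms [s - i] into [i + 1]. *)
rewrite size_rem // sls /= (reindex_inj rev_ord_inj) /=.
under eq_bigr => i _ do rewrite subKn ?ltn_ord //.
move=> /(leq_trans sX) le_all.
have : all (fun P => has (fun L => on_line L P) (rem L ls)) X.
  by rewrite all_count eqn_leq count_size le_all.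
by move=> /allP/(_ P PX)/hasP.
Qed.

(** * Fat points and vanishing along a line *)

Definition fat (m : nat) (X : seq (ppoint K)) F : Prop :=
  forall P, P \in X -> ideal_power (point_ideal P) m F.

Lemma point_ideal_eva (P : ppoint K) c F : point_ideal P F -> eva F (c *: pval P) = 0.
Proof.
move: F; apply: ideal_span_ind => [|F G eF eG|d g [t [hg g0]]].
- by rewrite evaE rmorph0.
- by rewrite p3_evalD eF eG addr0.
- by rewrite p3_evalM (eva_scale _ _ hg) g0 !mulr0.
Qed.

Lemma lin_mem (P : ppoint K) n : dot n (pval P) = 0 -> point_ideal P (lin n).
Proof.
by move=> nP; apply: ideal_span_mem; exists 1%N; split; [exact: homog_lin|rewrite eva_lin].
Qed.

Lemma seq_choice (T : eqType) (U : Type) (u0 : U) (Q : T -> U -> Prop) (r : seq T) :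
  {in r, forall x, exists u, Q x u} -> exists f, {in r, forall x, Q x (f x)}.
Proof.
elim: r => [|x r IH] h; first by exists (fun=> u0).
have [f hf] := IH (fun y hy => h y (mem_behead (s := x :: r) hy)).
have [u hu] := h x (mem_head _ _).
exists (fun y => if y == x then u else f y) => y; rewrite inE.
by case: eqP => [->|_] //= /hf.
Qed.

Lemma dvdp_prod_XsubC (rs : seq K) m (f : {poly K}) : uniq rs ->
  {in rs, forall r, ('X - r%:P) ^+ m %| f} ->
  (\prod_(r <- rs) ('X - r%:P)) ^+ m %| f.
Proof.
elim: rs => [|r rs IH] /=; first by rewrite big_nil expr1n dvd1p.
case/andP=> rrs urs hf; rewrite big_cons exprMn Gauss_dvdp.
  rewrite hf ?mem_head // IH // => x xrs.
  by apply: hf; rewrite inE xrs orbT.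
by rewrite coprimep_expl // coprimep_expr // coprimep_sym coprimep_XsubC root_prod_XsubC.
Qed.

(* Restricted to [L], [F] has degree less than the total multiplicity of its zeros. *)
Lemma fat_vanish_line (X : seq (ppoint K)) (L : pline K) m t F :
  uniq X -> (t < m * count (on_line L) X)%N -> homogeneous t F -> fat m X F ->
  forall a, dot (pval L) a = 0 -> eva F a = 0.
Proof.
move=> uX tm hF fF a La; pose Y := filter (on_line L) X.
have uY : uniq Y by rewrite filter_uniq.
rewrite -size_filter -/Y in tm.
have YL P : P \in Y -> dot (pval L) (pval P) = 0.
  by rewrite mem_filter on_lineE => /andP[/eqP].
have YX P : P \in Y -> P \in X by rewrite mem_filter => /andP[].
(* If [a] is a multiple of a point of [Y], evaluation at [a] kills the ideal of that point, so [F]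
   takes a value in the multiples of [0 ^+ m], and [tm] excludes [m = 0]. *)
have [/hasP[P PY /sub_rVP[c ->]]|nP] := boolP (has (fun P => a <= pval P)%MS Y).
  have [|q] := @ideal_power_morph (point_ideal P) K (ev idfun ((c *: pval P : 'rV_3) 0))
    0 m F _ (fF P (YX P PY)).
    by move=> f hf; exists 0; rewrite mulr0 -evaE point_ideal_eva.
  by rewrite -evaE => ->; case: m {fF} tm => // m _; rewrite exprS mul0r mulr0.
have [P1 P1Y] : exists P1, P1 \in Y.
  by case: (Y) tm => [|P1 ?]; rewrite ?muln0 // => _; exists P1; rewrite mem_head.
have nYa P : P \in Y -> ~~ (a <= pval P)%MS.
  by move=> PY; apply: contra nP => aP; apply/hasP; exists P.
(* Otherwise [a] serves as the point at infinity of the line, and every point of [Y] has a finite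
   parameter from the origin [P1]. *)
have [w hw] : exists w : ppoint K -> K,
    {in Y, forall P, exists2 c, c != 0 & pval P1 + w P *: a = c *: pval P}.
  apply: (@seq_choice _ _ 0 (fun P w =>
    exists2 c, c != 0 & pval P1 + w *: a = c *: pval P)).
  move=> P PY; have [||u [v eP]] :=
    @plane_span (pval L) a (pval P1) (pval P) (pvec_neq0 L) La (YL _ P1Y) (YL _ PY).
  - exact: pvec_neq0.
  - exact: nYa.
  have v0 : v != 0.
    apply/eqP=> v0; rewrite v0 scale0r addr0 in eP.
    have u0 : u != 0 by apply/eqP=> u0; have := pvec_neq0 P; rewrite eP u0 scale0r eqxx.
    by have := nYa P PY; rewrite eP (eqmx_scale _ u0) submx_refl.
  exists (v^-1 * u), v^-1; first by rewrite invr_eq0.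
  by rewrite eP scalerDr !scalerA mulVf // scale1r addrC.
have uw : uniq (map w Y).
  rewrite map_inj_in_uniq // => P Q PY QY e.
  have [c c0 eP] := hw P PY; have [d d0 eQ] := hw Q QY.
  apply: (@pvec_prop _ _ (c^-1 * d)); rewrite -scalerA -eQ -e eP scalerA mulVf //.
  by rewrite scale1r.
have f0 : restr (pval P1) a F = 0.
  apply/eqP/negPn/negP => f0.
  have /dvdp_leq : (\prod_(r <- map w Y) ('X - r%:P)) ^+ m %| restr (pval P1) a F.
    apply: dvdp_prod_XsubC uw _ => _ /mapP[P PY ->].
    have [|q ->] := @ideal_power_morph (point_ideal P) _ (restr (pval P1) a)
       ('X - (w P)%:P) m F _ (fF P (YX P PY)); last exact: dvdp_mull.
    move=> f hf; apply/factor_theorem; rewrite rootE horner_restr.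
    by have [c _ ->] := hw P PY; rewrite (point_ideal_eva _ hf).
  move=> /(_ f0) /leq_trans /(_ (size_restr (pval P1) a hF)).
  (* The lemma [size_exp] concerns the predecessor of the size, that is the degree, here
     [m * size Y], which exceeds [t]. *)
  have pred_le N : (N <= t.+1)%N -> (N.-1 <= t)%N by lia.
  by move=> /pred_le; rewrite size_exp size_prod_XsubC size_map /= mulnC leqNgt tm.
by have := restr_eq0 0 1 hF f0; rewrite scale0r add0r scale1r.
Qed.
(** * Restriction to a generic line *)

(** The vector is sought on the moment curve [(1, z, z^2)], where each condition becomes that a
    nonzero polynomial does not vanish at [z]. *)
Lemma avoid_planes (vs : seq 'rV[K]_3) : {in vs, forall v, v != 0} ->
  exists a, {in vs, forall v, dot v a != 0}.
Proof.
move=> hvs; pose p (v : 'rV[K]_3) := \poly_(i < 3) v 0 (inord i).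
have p0 v : v != 0 -> p v != 0.
  apply: contra => /eqP/polyP pv; apply/eqP/rowP => i; have := pv i.
  by rewrite coef_poly ltn_ord inord_val coef0 mxE.
have /closed_nonrootP[z] : \prod_(v <- vs) p v != 0.
  by rewrite prodf_seq_neq0; apply/allP => v /hvs /p0.
rewrite /root horner_prod prodf_seq_neq0 => /allP hz.
exists (\row_i z ^+ i) => v /hz /=; rewrite /p horner_poly.
rewrite /dot; under eq_bigr => i _ do rewrite inord_val.
by under [X in _ -> X != 0]eq_bigr => i _ do rewrite mxE.
Qed.

Definition cross (u v : 'rV[K]_3) : 'rV[K]_3 := \row_i
  if i == 0 then u 0 1%:R * v 0 2%:R - u 0 2%:R * v 0 1%:R
  else if i == 1%:R then u 0 2%:R * v 0 0 - u 0 0 * v 0 2%:R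
  else u 0 0 * v 0 1%:R - u 0 1%:R * v 0 0.

Lemma dot_crossC u v w : dot (cross u v) w = dot (cross v w) u.
Proof. rewrite /dot !sum3 !mxE /=; ring. Qed.

Lemma dot_cross_l u v : dot (cross u v) u = 0.
Proof. rewrite /dot !sum3 !mxE /=; ring. Qed.

Lemma dot_cross_r u v : dot (cross u v) v = 0.
Proof. rewrite /dot !sum3 !mxE /=; ring. Qed.

(** Up to sign, the coordinates of [u - u 0 k *: v] are entries of the cross product or trivially
    0. *)
Lemma cross_eq0 u v k : cross u v = 0 -> v 0 k = 1 -> u = u 0 k *: v.
Proof.
move=> /rowP e vk; have e0 := e 0; have e1 := e 1%:R; have e2 := e 2%:R.
rewrite !mxE /= in e0 e1 e2.
apply/rowP=> i; rewrite mxE -[LHS]mulr1 -vk.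
move: k i {vk}; apply: ord3_ind; apply: ord3_ind; apply/eqP; rewrite -subr_eq0; apply/eqP.
all: first [by rewrite mulrC subrr | exact: e0 | exact: e1 | exact: e2
  | by rewrite -oppr0 -e0 opprB | by rewrite -oppr0 -e1 opprB
  | by rewrite -oppr0 -e2 opprB].
Qed.
Lemma ideal_powerMr I m F G : ideal_power I m F -> ideal_power I m (F * G).
Proof. by move=> h; rewrite mulrC; apply: ideal_spanM. Qed.

Lemma fatM k l X F G : fat k X F -> fat l X G -> fat (k + l) X (F * G).
Proof. by move=> hF hG P PX; apply: ideal_powerM; [apply: hF|apply: hG]. Qed.

(** * Lifting polynomials from the generic line *)

Section GenericLine.
Variables (X : seq (ppoint K)) (ls : seq (pline K)) (s : nat) (A B : 'rV[K]_3).
Hypotheses (uls : uniq ls) (sls : size ls = s.+1) (s_gt1 : (1 < s)%N).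
Hypothesis X_lines : {in X & ls, forall P L, exists2 L', L' \in rem L ls & on_line L' P}.
Hypothesis B_ls : {in ls, forall L, dot (pval L) B != 0}.
Hypothesis A_ls : {in ls &, forall L1 L2, L1 != L2 ->
  dot (pval L1) A * dot (pval L2) B != dot (pval L2) A * dot (pval L1) B}.
Local Notation res := (restr A B).

(** Here [g] is the dehomogenised shape of a binary form of degree [t], so [t] has to be recorded
    separately. *)
Definition lifts (k t : nat) (g : {poly K}) : Prop :=
  exists G, [/\ homogeneous t G, fat k X G & res G = g].

Lemma liftsM k t g l u h : lifts k t g -> lifts l u h -> lifts (k + l) (t + u) (g * h).
Proof.
move=> [G [hG fG <-]] [H [hH fH <-]]; exists (G * H).
by rewrite rmorphM; split=> //; [apply: homogM|apply: fatM].
Qed.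

Lemma two_lines_ls : exists L1 L2, [/\ L1 \in ls, L2 \in ls & L1 != L2].
Proof.
case: (ls) uls sls s_gt1 => [|L1 [|L2 ls']] //=; first by move=> _ [<-].
rewrite inE negb_or => /andP[/andP[L12 _] _] _ _.
by exists L1, L2; rewrite !inE !eqxx orbT.
Qed.

(** Cramer's rule for two of the lines: [D] is the determinant of their values at [A] and [B],
    nonzero by [A_ls]. *)
Lemma lifts_lin : lifts 0 1 1 /\ lifts 0 1 'X.
Proof.
have [L1 [L2 [L1s L2s L12]]] := two_lines_ls.
have D0 := A_ls L1s L2s L12; rewrite -subr_eq0 in D0.
set D := _ - _ in D0.
have fat0 F : fat 0 X F by move=> P _; apply: ideal_power0.
split.
  exists (lin (D^-1 *: (dot (pval L2) B *: pval L1 + (- dot (pval L1) B) *: pval L2))).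
  split=> //; first exact: homog_lin.
  rewrite restr_lin ![dot _ A]dotC ![dot _ B]dotC !dotZr !dotDr !dotZr.
  rewrite ![dot A _]dotC ![dot B _]dotC.
  rewrite [X in X%:P + _](_ : _ = 1); last by rewrite /D; field.
  by rewrite [X in _ + X%:P * _](_ : _ = 0) ?mul0r ?addr0 //; ring.
exists (lin (D^-1 *: (dot (pval L1) A *: pval L2 + (- dot (pval L2) A) *: pval L1))).
split=> //; first exact: homog_lin.
rewrite restr_lin ![dot _ A]dotC ![dot _ B]dotC !dotZr !dotDr !dotZr.
rewrite ![dot A _]dotC ![dot B _]dotC.
rewrite [X in _ + X%:P * _](_ : _ = 1); last by rewrite /D; field.
by rewrite [X in X%:P + _](_ : _ = 0) ?mul1r ?add0r //; ring.
Qed.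

Lemma lifts0 r e : (e <= r)%N -> lifts 0 r 'X^e.
Proof.
have [l1 lX] := lifts_lin; elim: r e => [|r IH] [|e] // er.
- by exists 1; rewrite rmorph1; split=> //; [exact: homog1|move=> P _; apply: ideal_power0].
- by have := liftsM l1 (IH 0%N isT); rewrite mul1r.
- by rewrite exprS; apply: (liftsM lX (IH e er)).
Qed.

(** The parameter at which [A + w B] meets [L]; it is finite by [B_ls], and [A_ls] separates the
    parameters of distinct lines. *)
Definition line_root (L : pline K) : K := - (dot (pval L) A / dot (pval L) B).

Lemma restr_line L : L \in ls -> res (lin (pval L)) = dot (pval L) B *: ('X - (line_root L)%:P).
Proof.
move=> Ls; rewrite restr_lin -mul_polyC mulrBr -polyCM addrC; congr (_ + _).
by rewrite /line_root mulrN polyCN opprK mulrC divfK ?B_ls.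
Qed.

Lemma line_root_inj : {in ls &, injective line_root}.
Proof.
move=> L1 L2 L1s L2s /oppr_inj/eqP; rewrite eqr_div ?B_ls // => e.
by apply/eqP; apply: contraTT e => /(A_ls L1s L2s).
Qed.

Definition others (L : pline K) : R3 := \prod_(L' <- rem L ls) lin (pval L').

Lemma others_homog L : L \in ls -> homogeneous s (others L).
Proof.
by move=> Ls; have := @homog_prod_lin _ (rem L ls) (@pval K); rewrite size_rem // sls.
Qed.

Lemma others_fat L : L \in ls -> fat 1 X (others L).
Proof.
move=> Ls P PX; have [L' L's /eqP L'P] := X_lines PX Ls.
rewrite /others (perm_big _ (perm_to_rem L's)) big_cons.
exact/ideal_powerMr/ideal_power1/lin_mem.
Qed.

(* Lagrange interpolation at the points where the lines meet [l]. *)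
Lemma lifts_interp (g : {poly K}) : (size g <= s.+1)%N -> lifts 1 s g.
Proof.
move=> sg; pose c L := g.[line_root L] / (res (others L)).[line_root L].
exists (\sum_(L <- ls) cst3 (c L) * others L); split.
- rewrite big_seq; apply: (big_ind (homogeneous s)) => [||L Ls].
  + exact: homog0.
  + exact: homogD.
  + exact/homogZ/others_homog.
- move=> P PX; rewrite big_seq.
  apply: (big_ind (ideal_power (point_ideal P) 1)) => [||L Ls].
  + exact: ideal_span0.
  + exact: ideal_spanD.
  + by apply: ideal_spanM; apply: others_fat.
set G := \sum_(L <- ls) _.
have sG : (size (res G) <= s.+1)%N.
  apply: size_restr; rewrite /G big_seq.
  apply: (big_ind (homogeneous s)) => [||L Ls].
  + exact: homog0.
  + exact: homogD.
  + exact/homogZ/others_homog.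
have oE L x : L \in ls -> (res (others L)).[x] =
    \prod_(L' <- rem L ls) (dot (pval L') B * (x - line_root L')).
  move=> Ls; rewrite rmorph_prod horner_prod [LHS]big_seq [RHS]big_seq.
  apply: eq_bigr => L' /mem_rem L's.
  by rewrite (restr_line L's) hornerZ hornerXsubC.
apply/eqP; rewrite -subr_eq0; apply/negPn/negP => nz.
(* A nonzero difference of size at most [s + 1] cannot have these [s + 1] distinct roots. *)
have /(max_poly_roots nz) : all (root (res G - g)) (map line_root ls).
  apply/allP => _ /mapP[L Ls ->]; rewrite rootE hornerD hornerN subr_eq0.
  rewrite rmorph_sum horner_sum (bigD1_seq L) //= big_seq_cond big1 => [|L' /andP[L's L'L]].
    rewrite addr0 rmorphM restr_const hornerM hornerC /c divfK // oE // prodf_seq_neq0.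
    apply/allP => L' L's /=; have L's' := mem_rem L's.
    rewrite mulf_neq0 ?B_ls // subr_eq0; apply/eqP => /(line_root_inj Ls L's') LL'.
    by move: L's; rewrite -LL' mem_rem_uniq // !inE eqxx.
  rewrite rmorphM hornerM oE // (big_rem L) /=; last first.
    by rewrite mem_rem_uniq // !inE Ls eq_sym L'L.
  by rewrite subrr mulr0 mul0r mulr0.
rewrite map_inj_in_uniq; last exact: line_root_inj.
move=> /(_ uls); rewrite size_map sls ltnNge => /negP; apply.
by apply: leq_trans (size_polyD _ _) _; rewrite size_polyN geq_max sG sg.
Qed.

(** An exponent [minn e s] is split off [k] times, each factor being lifted to order 1 by
    interpolation; what remains is at most [r] and lifts to order 0. *)
Lemma lifts_monomial k r e : (e <= k * s + r)%N -> lifts k (k * s + r) 'X^e.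
Proof.
elim: k e => [|k IH] e he; first exact: lifts0.
have -> : e = (minn e s + (e - minn e s))%N by rewrite subnKC // geq_minl.
rewrite exprD mulSn -addnA -add1n; apply: liftsM.
  by apply: lifts_interp; rewrite size_polyXn ltnS geq_minr.
by apply: IH; lia.
Qed.

Definition all_lines : R3 := \prod_(L <- ls) lin (pval L).

Lemma all_lines_fat : fat 2 X all_lines.
Proof.
move=> P PX; have [L1 [_ [L1s _ _]]] := two_lines_ls.
have [L /mem_rem Ls /eqP LP] := X_lines PX L1s.
rewrite /all_lines (perm_big _ (perm_to_rem Ls)) big_cons -addn1.
by apply: ideal_powerM; [apply/ideal_power1/lin_mem|apply: others_fat].
Qed.

Lemma all_lines_homog : homogeneous s.+1 all_lines.
Proof. by have := @homog_prod_lin _ ls (@pval K); rewrite sls. Qed.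

Lemma restr_all_lines : exists2 c, c != 0 &
  res all_lines = c *: \prod_(r <- map line_root ls) ('X - r%:P).
Proof.
exists (\prod_(L <- ls) dot (pval L) B).
  by rewrite prodf_seq_neq0; apply/allP => L /B_ls.
rewrite rmorph_prod big_map -scaler_prod big_seq [RHS]big_seq.
by apply: eq_bigr => L /restr_line.
Qed.

Lemma size_restr_all_lines : size (res all_lines) = s.+2.
Proof.
have [c c0 ->] := restr_all_lines.
by rewrite size_scale // size_prod_XsubC size_map sls.
Qed.

Lemma restr_all_lines_dvd p : {in ls, forall L, p.[line_root L] = 0} -> res all_lines %| p.
Proof.
move=> hp; have [c c0 ->] := restr_all_lines; rewrite dvdpZl //.
rewrite -[\prod_(_ <- _) _]expr1; apply: dvdp_prod_XsubC.
  by rewrite map_inj_in_uniq //; apply: line_root_inj.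
by move=> _ /mapP[L Ls ->]; rewrite expr1 dvdp_XsubCl rootE hp.
Qed.
End GenericLine.

(** * Dimension of the forms in the fat ideal *)

Definition fat_form m X t F : Prop := homogeneous t F /\ fat m X F.

Lemma fat_form_subspace m X t : subspace (fat_form m X t).
Proof.
split; first by split=> [|P _]; [exact: homog0|exact: ideal_span0].
split=> [F G [hF fF] [hG fG]|c F [hF fF]].
  by split=> [|P PX]; [exact: homogD|apply: ideal_spanD; [apply: fF|apply: fG]].
by split=> [|P PX]; [exact: homogZ|apply: ideal_spanM; apply: fF].
Qed.

(** First [B] is chosen off all the lines, then [A] off finitely many planes. A point of [X] lies on
    some line and [B] does not, so the cross product of [B] with that point is nonzero. *)
Lemma generic_line (X : seq (ppoint K)) (ls : seq (pline K)) :
  uniq ls -> {in X, forall P, has (fun L => on_line L P) ls} ->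
  exists A B, [/\ {in ls, forall L, dot (pval L) B != 0},
    {in ls &, forall L1 L2, L1 != L2 ->
       dot (pval L1) A * dot (pval L2) B != dot (pval L2) A * dot (pval L1) B} &
    {in X, forall P, dot (cross A B) (pval P) != 0}].
Proof.
move=> uls hX; have [|B hB] := @avoid_planes [seq pval L | L <- ls].
  by move=> _ /mapP[L _ ->]; apply: pvec_neq0.
have {}hB : {in ls, forall L, dot (pval L) B != 0}.
  by move=> L Ls; apply: hB; apply: map_f.
(* The member through [B] of the pencil spanned by [L1] and [L2]; if [A] avoids it, the two lines
   meet the line [AB] in different points. *)
pose v (L1 L2 : pline K) := dot (pval L2) B *: pval L1 + (- dot (pval L1) B) *: pval L2.
have [|A hA] := @avoid_planes ([seq v L1 L2 | L1 <- ls, L2 <- rem L1 ls]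
    ++ [seq cross B (pval P) | P <- X]).
  move=> w; rewrite mem_cat => /orP[/allpairsPdep[L1 [L2 [L1s]]]|/mapP[P PX ->]].
    rewrite mem_rem_uniq // inE => /andP[L21 L2s] ->; apply: contra L21.
    rewrite /v scaleNr subr_eq0 => /eqP e; apply/eqP.
    apply: (@pvec_prop _ _ ((dot (pval L1) B)^-1 * dot (pval L2) B)).
    by rewrite -scalerA e scalerA mulVf ?scale1r ?hB.
  have [k Pk] := pvec_coord P; apply/eqP => /cross_eq0/(_ Pk) eB.
  have /hasP[L Ls /eqP LP] := hX P PX.
  by have := hB L Ls; rewrite eB dotZr [dot _ _]LP mulr0 eqxx.
exists A, B; split=> // [L1 L2 L1s L2s L12|P PX].
  have := hA (v L1 L2); rewrite mem_cat allpairs_f_dep //; last first.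
    by rewrite mem_rem_uniq // inE eq_sym L12.
  move=> /(_ isT); rewrite /v dotC dotDr !dotZr mulNr subr_eq0 ![dot A _]dotC.
  by rewrite mulrC [X in _ != X]mulrC.
rewrite dot_crossC; apply: hA.
by rewrite mem_cat (map_f (fun P : ppoint K => cross B (pval P)) PX) orbT.
Qed.

(** The exact sequence is multiplication by [lin n], the equation of the line through [A] and [B],
    followed by the coefficients of the restriction divided by [q]. *)
Lemma dim_fat_forms (X : seq (ppoint K)) (ls : seq (pline K)) s m :
  uniq X -> (size X <= \sum_(i < s) i.+1)%N -> uniq ls -> size ls = s.+1 ->
  {in ls, forall L, count (on_line L) X = s} -> (1 < s)%N -> (1 < m)%N ->
  forall d, dim_is (fat_form m X (m * s - 2)) d ->
    dim_is (fat_form m X (m * s - 1)) (d + (m * s - s.+1)).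
Proof.
move=> uX sX uls sls hs s_gt1 m_gt1 d.
have ms : (2 * s <= m * s)%N by rewrite leq_mul2r m_gt1 orbT.
have X_lines := two_lines uX sX uls sls hs.
have [L0 L0s] : exists L0, L0 \in ls.
  by case: (ls) sls => // L0 ls' _; exists L0; rewrite mem_head.
have [|A [B [hB hAB hX]]] := @generic_line X ls uls.
  by move=> P PX; have [L /mem_rem Ls LP] := X_lines P L0 PX L0s; apply/hasP; exists L.
have [P0 P0X] : exists P0, P0 \in X.
  by case: (X) (hs L0 L0s) => [|P0 ? _] /=; [lia|exists P0; rewrite mem_head].
set n := cross A B in hX *.
have n0 : n != 0.
  apply: contraTneq (hX P0 P0X) => ->; rewrite negbK /dot big1 // => i _.
  by rewrite mxE mul0r.
have lin0 : lin n != 0.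
  by apply: contraTneq (hX P0 P0X) => e; rewrite -eva_lin e evaE rmorph0 eqxx.
have hom1 t F : (0 < t)%N -> homogeneous (t - 1) F -> homogeneous t (lin n * F).
  by case: t => // t _; rewrite subn1; apply: (homogM (@homog_lin n)).
pose q := restr A B (all_lines ls).
have sq : size q = s.+2 by apply: size_restr_all_lines.
have q0 : q != 0 by rewrite -size_poly_eq0 sq.
have res_lin0 : restr A B (lin n) = 0.
  by rewrite restr_lin dot_cross_l dot_cross_r mul0r addr0.
have vanish F : fat_form m X (m * s - 1) F -> q %| restr A B F.
  move=> [hF fF]; apply: (restr_all_lines_dvd uls) => // L Ls.
  rewrite horner_restr; apply: (fat_vanish_line (L := L) uX _ hF fF).
    by rewrite hs //; lia.
  by rewrite dotDr dotZr /line_root mulNr divfK ?hB // subrr.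
have span_n a : dot n a = 0 -> exists u v, a = u *: A + v *: B.
  move=> na; have [L1 [L2 [L1s L2s L12]]] := two_lines_ls uls sls s_gt1.
  apply: plane_span n0 _ _ na _ _; rewrite ?dot_cross_l ?dot_cross_r //.
    apply: contraTneq (hB L0 L0s) => ->; rewrite negbK /dot big1 // => i _.
    by rewrite mxE mulr0.
  (* If [A] were a multiple of [B], the two sides of the inequality [hAB] would coincide. *)
  apply: contra (hAB _ _ L1s L2s L12) => /sub_rVP[c ->].
  by rewrite !dotZr mulrAC.
(* The restriction has degree at most [m * s - 1] and [q] has degree [s + 1], so [m * s - s.+1]
   coefficients determine the quotient. *)
apply: (@dim_exact _ _ (lin n) _ _
  (fun F => \row_(j < m * s - s.+1) (restr A B F %/ q)`_j)) => //.
- exact: fat_form_subspace.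
- by move=> F G; apply/rowP=> j; rewrite !mxE rmorphD divpD coefD.
- move=> c F; apply/rowP=> j.
  by rewrite !mxE rmorphM restr_const mul_polyC divpZl coefZ.
- move=> F [hF fF]; split; last first.
    by apply/rowP=> j; rewrite !mxE rmorphM res_lin0 mul0r div0p coef0.
  split; last by move=> P PX; apply: ideal_spanM; apply: fF.
  by apply: hom1; [lia|rewrite -subnDA].
(* Exactness of the division by [q] gives a zero restriction, so [lin n] divides [F]; the cofactor
   keeps order [m] because the line misses [X]. *)
- move=> F VF phi0; have res0 : restr A B F = 0.
    rewrite -(divpK (vanish F VF)); suff -> : restr A B F %/ q = 0 by rewrite mul0r.
    apply/polyP=> j; rewrite coef0; have [je|ej] := ltnP j (m * s - s.+1).
      by have /rowP/(_ (Ordinal je)) := phi0; rewrite !mxE.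
    apply: nth_default; apply: leq_trans ej; rewrite size_divp // sq.
    by apply: leq_trans (leq_sub2r _ (size_restr A B VF.1)) _; lia.
  have [G eF] : exists G, F = lin n * G.
    by apply: lin_dvd n0 _ => a /span_n[u [v ->]]; apply: restr_eq0 VF.1 res0.
  exists G => //; have [hF fF] := VF; rewrite eF in hF fF; split.
    apply: (homog_cofactor lin0 (@homog_lin n)).
    by rewrite (_ : (1 + _ = m * s - 1)%N) //; lia.
  by move=> P PX; apply: ideal_power_cofactor (hX P PX) (fF P PX).
(* The unit vector [i] comes from ['X^i] lifted to order [m - 2]; the factor [all_lines ls] supplies
   the missing order 2 and degree [s + 1]. *)
- move=> i; have le_i : (i <= (m - 2) * s + (s - 2))%N.
    by have := ltn_ord i; rewrite mulnBl; lia.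
  have [G [hG fG eG]] := lifts_monomial uls sls s_gt1 X_lines hB hAB le_i.
  exists (all_lines ls * G).
    split.
      have -> : (m * s - 1 = s.+1 + ((m - 2) * s + (s - 2)))%N by rewrite mulnBl; lia.
      exact: homogM (all_lines_homog sls) hG.
    have -> : m = (2 + (m - 2))%N by lia.
    exact: fatM (all_lines_fat uls sls s_gt1 X_lines) fG.
  apply/rowP=> j; rewrite !mxE rmorphM eG mulKp // coefXn.
  by rewrite eqxx /= eq_sym -val_eqE eq_sym.
Qed.

(** * Passage to sequences and to the nested polynomials *)

Definition lin_independent (fs : seq R3) : Prop :=
  forall cs : seq K, size cs = size fs ->
    \sum_(i < size fs) cst3 cs`_i * fs`_i = 0 ->
    forall i, (i < size cs)%N -> cs`_i = 0.

Lemma lin_independentP d (fs : seq R3) : size fs = d ->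
  lin_independent fs <-> indep (fun i : 'I_d => fs`_i).
Proof.
move=> <-; split=> [h c c0 i|h cs scs c0 i].
  have e (k : 'I_(size fs)) : (mkseq (fun k => if insub k is Some k' then c k' else 0)
      (size fs))`_k = c k.
    by rewrite nth_mkseq // valK.
  rewrite -e; apply: h; rewrite ?size_mkseq //.
  by rewrite -[RHS]c0; apply: eq_bigr => k _; rewrite e.
rewrite scs => isf; exact: (h (fun k => cs`_k) c0 (Ordinal isf)).
Qed.

Lemma dim_is_seq (V : R3 -> Prop) d : dim_is V d ->
  (exists fs : seq R3, size fs = d /\ (forall i, (i < d)%N -> V fs`_i)
                       /\ lin_independent fs) /\
  (forall fs : seq R3, size fs = d.+1 -> (forall i, (i < d.+1)%N -> V fs`_i)
                       -> ~ lin_independent fs).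
Proof.
move=> [[f [hf fi]] max]; split=> [|fs sfs hfs].
  have e (k : 'I_d) : [seq f i | i <- enum 'I_d]`_k = f k.
    by rewrite (nth_map k) ?size_enum_ord // nth_ord_enum.
  have sf : size [seq f i | i <- enum 'I_d] = d by rewrite size_map size_enum_ord.
  exists [seq f i | i <- enum 'I_d]; split=> //; split.
    by move=> i id; have := e (Ordinal id); rewrite /= => ->.
  apply/(lin_independentP sf) => c c0; apply: fi.
  by rewrite -[RHS]c0; apply: eq_bigr => k _; rewrite e.
move/(lin_independentP sfs); apply: max => i; exact: hfs.
Qed.
End FatPoints.

(** The abstract notions repeat those of the statement, so at [nested_poly3] both sides agree by
    conversion. *)
Lemma dim_is_is_dim (K : closedFieldType) (V : R3 K -> Prop) d :
  dim_is (nested_poly3 K) V d -> is_dim V d.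
Proof. exact: dim_is_seq. Qed.

Lemma fat_form_dim (K : closedFieldType) (X : seq (ppoint K)) m t d :
  dim_is (nested_poly3 K) (fat_form (nested_poly3 K) m X t) d ->
  is_dim (fun F => homog t F /\ fat_ideal m X F) d.
Proof. exact: dim_is_is_dim. Qed.

Theorem theorem4p2 (K : closedFieldType) (s : nat) (X : seq (ppoint K)) :
  (2 <= s)%N ->
  kconfig X (iota 1 s) ->
  (exists ls : seq (pline K), uniq ls /\ size ls = s.+1 /\
     (forall L : pline K, L \in ls <-> count (on_line L) X = s)) ->
  forall m : nat, (2 <= m)%N ->
    exists h1 h0 : nat,
      hilb (fat_ideal m X) (m * s - 1) h1 /\
      hilb (fat_ideal m X) (m * s - 2) h0 /\
      (Posz h1 - Posz h0)%R = Posz s.+1.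
Proof.
move=> s_gt1 hk [ls [uls [sls hls]]] m m_gt1.
have uX := hk.1; have sX := kconfig_size hk.
have hs : {in ls, forall L, count (on_line L) X = s} by move=> L /hls.
have [D hD] := dim_homog_ex (nested_poly3 K) (m * s - 2).
have le_ms : (2 * s <= m * s)%N by rewrite leq_mul2r m_gt1 orbT.
have e1 : (m * s - 2).+1 = (m * s - 1)%N by lia.
have e2 : (m * s - 2).+2 = (m * s)%N by lia.
have := dim_homogS hD; rewrite e2 e1 => hD1.
have sub F : fat_form (nested_poly3 K) m X (m * s - 2) F ->
  homogeneous (nested_poly3 K) (m * s - 2) F by case.
have [d dD hd] := dim_sub sub hD.
have hd1 := dim_fat_forms uX sX uls sls hs s_gt1 m_gt1 hd.
(* The truncated subtractions are exact since [d <= D] and [s.+1 <= m * s]; the two values differ by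
   [m * s - (m * s - s.+1)]. *)
exists (D + m * s - (d + (m * s - s.+1)))%N, (D - d)%N; split.
  exists (D + m * s)%N, (d + (m * s - s.+1))%N.
  by split; [exact: dim_is_is_dim hD1|split=> //; exact: fat_form_dim hd1].
split; last by lia.
by exists D, d; split; [exact: dim_is_is_dim hD|split=> //; exact: fat_form_dim hd].
Qed.
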